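(* $\rho\tau(K_{12}, o(\mathbf{Q}(4,n))) \le 4/13$. That is, for every $\gamma>0$ there is $\delta>0$ such that every $n$-vertex $K_{12}$-free graph $G$ with $\alpha(G)\le \delta\,\mathbf{Q}(4,n)$ satisfies $e(G)\le (4/13+\gamma)n^2$ for all sufficiently large $n$.
   Context: For a graph $H$ and a function $f(n)$, the Ramsey–Turán number $\mathbf{RT}(n,H,f(n))$ is the maximum number of edges in an $n$-vertex $H$-free graph with independence number at most $f(n)$. Let $\overline{\rho\tau}(H,f)=\limsup_{n\to\infty}\mathbf{RT}(n,H,f(n))/n^2$ and $\underline{\rho\tau}(H,f)=\liminf_{n\to\infty}\mathbf{RT}(n,H,f(n))/n^2$; when they coincide, their common value is $\rho\tau(H,f)$. Further $\rho\tau(H,o(f)) := \lim_{\delta\to 0}\rho\tau(H,\delta f)$; an upper bound $\rho\tau(H,o(f))\le c$ means $\lim_{\delta\to0}\overline{\rho\tau}(H,\delta f)\le c$. The inverse Ramsey number $\mathbf{Q}(t,n)$ is the minimum independence number of a $K_t$-free graph on $n$ vertices. *)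

(* Defs.v *)
From HB Require Import structures.
From mathcomp Require Import all_boot all_order all_algebra.
From mathcomp Require Import all_classical all_reals all_analysis.
Set Implicit Arguments.
Unset Strict Implicit.
Unset Printing Implicit Defensive.
Import Order.TTheory GRing.Theory Num.Theory.
Import numFieldNormedType.Exports.
Local Open Scope ring_scope.

Record sgraph (T : finType) := SGraph {
  edges :> {set {set T}} ;
  edges2 : [forall A in edges, #|A| == 2%N] }.

HB.instance Definition _ (T : finType) := [isSub for @edges T].
HB.instance Definition _ (T : finType) := [Finite of sgraph T by <:].

Local Open Scope set_scope.

Lemma complete_subproof (T : finType) :
  [forall A in [set A : {set T} | #|A| == 2%N], #|A| == 2%N].
Proof. by apply/forall_inP => A; rewrite inE. Qed.

Definition complete_on (T : finType) : sgraph T :=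
  SGraph (complete_subproof T).

Definition complete_graph (t : nat) : sgraph 'I_t := complete_on 'I_t.

(* Copies of H need not be induced. *)
Definition contains_copy (T U : finType) (G : sgraph T) (H : sgraph U) : bool :=
  [exists h : {ffun U -> T},
    injectiveb h && [forall A in edges H, h @: A \in edges G]].

Definition free_of (T U : finType) (H : sgraph U) (G : sgraph T) : bool :=
  ~~ contains_copy G H.

Definition independent (T : finType) (G : sgraph T) (S : {set T}) : bool :=
  [forall A in edges G, ~~ (A \subset S)].

Definition indep_number (T : finType) (G : sgraph T) : nat :=
  (\max_(S : {set T} | independent G S) #|S|)%N.

(* The maximum over an empty family of graphs is 0. *)
Definition ramsey_turan (R : realType) (U : finType) (n : nat) (H : sgraph U)
    (x : R) : nat :=
  (\max_(G : sgraph 'I_n | free_of H G && ((indep_number G)%:R <= x)%R)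
     #|edges G|)%N.

(* Every graph on n vertices has independence number at most n, so the default
   value n does not affect the minimum; for t >= 2 it is attained by the
   edgeless graph. *)
Definition inverse_ramsey (t n : nat) : nat :=
  \big[minn/n]_(G : sgraph 'I_n | free_of (complete_graph t) G) indep_number G.

Local Open Scope classical_set_scope.

Definition rho_tau_sup (R : realType) (U : finType) (H : sgraph U)
    (f : nat -> R) : \bar R :=
  limn_esup (fun n : nat => ((ramsey_turan n H (f n))%:R / (n%:R ^+ 2))%:E).

Definition rho_tau_sup_scaled (R : realType) (U : finType) (H : sgraph U)
    (f : nat -> R) (delta : R) : \bar R :=
  rho_tau_sup H (fun n => delta * f n).

(* The limit of rho-tau-bar(H, delta f) as delta decreases to 0.  For f >= 0
   the quantity is nondecreasing in delta, so the limit exists in \bar R. *)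
Definition rho_tau_sup_o (R : realType) (U : finType) (H : sgraph U)
    (f : nat -> R) : \bar R :=
  lim (rho_tau_sup_scaled H f delta @[delta --> 0^'+]).

(* Main.v *)
Require Import Defs.
From HB Require Import structures.
From mathcomp Require Import all_boot all_order all_algebra.
From mathcomp Require Import ring lra zify.
Set Implicit Arguments.
Unset Strict Implicit.
Unset Printing Implicit Defensive.
Import Order.TTheory GRing.Theory Num.Theory.
Local Open Scope ring_scope.

(** The density of pairs of clusters of a regular partition takes effectively
    only two positive values.  If a pair has density more than 3/4, then the four
    vertices of a K_4 in one cluster have linearly many common neighbours in the
    other, and every linear-sized set contains a K_4, since boundedly many disjoint
    copies of a K_4-free one would beat Q(4, n).  Hence three clusters with pairwise
    densities above 3/4 yield K_12 as 3 x K_4.  On the other hand Q(4, n) is at most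
    n^(9/20) up to a constant, by the deletion method, so that already sets of size
    n^(39/40) - 1 contain triangles; if G has
    a positive density of K_4, iterated dependent random choice with polynomially
    small losses then yields K_12 as 4 x K_3.  So the reduced graph is K_4-free and
    its edges of density above 3/4 span no triangle.  Shifting weights to a clique,
    the Lagrangian of a triangle with weights 1, 1, 3/4 gives 2 e(G) <= 8/13 n^2. *)

(** * A lower regularity lemma *)

Lemma sum_constT (R : pzRingType) (T : finType) (c : R) :
  \sum_(x : T) c = c * #|T|%:R.
Proof. by rewrite mulr_natr -sumr_const; apply: eq_bigl. Qed.

Section Density.
Variables (R : realFieldType) (V : finType) (f : V -> V -> R).
Implicit Types X Y : {set V}.

Definition edge_sum X Y : R := \sum_(x in X) \sum_(y in Y) f x y.
Definition dens X Y : R := edge_sum X Y / (#|X|%:R * #|Y|%:R).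
Definition lower_regular (eps : R) X Y : bool :=
  [forall X' : {set V}, forall Y' : {set V},
    [&& X' \subset X, Y' \subset Y, eps * #|X|%:R <= #|X'|%:R
      & eps * #|Y|%:R <= #|Y'|%:R] ==>
    ((dens X Y - eps) * (#|X'|%:R * #|Y'|%:R) <= edge_sum X' Y')].

Hypothesis f01 : forall x y, 0 <= f x y <= 1.

Lemma edge_sum_ge0 X Y : 0 <= edge_sum X Y.
Proof.
by apply: sumr_ge0 => x _; apply: sumr_ge0 => y _; have /andP[] := f01 x y.
Qed.

Lemma sum_const2 X Y (c : R) :
  \sum_(x in X) \sum_(y in Y) c = c * (#|X|%:R * #|Y|%:R).
Proof. rewrite !sumr_const -mulr_natr -[c *+ _]mulr_natr; ring. Qed.

Lemma edge_sum_le X Y : edge_sum X Y <= #|X|%:R * #|Y|%:R.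
Proof.
rewrite -[leRHS]mul1r -sum_const2.
by apply: ler_sum => x _; apply: ler_sum => y _; have /andP[] := f01 x y.
Qed.

Lemma densK X Y : dens X Y * (#|X|%:R * #|Y|%:R) = edge_sum X Y.
Proof.
rewrite /dens; have [e|ne] := eqVneq (#|X|%:R * #|Y|%:R : R) 0; last first.
  by rewrite divfK.
by apply/esym/eqP; rewrite e mulr0 eq_le edge_sum_ge0 andbT (le_trans (edge_sum_le X Y)) // e.
Qed.

Lemma dens_ge0 X Y : 0 <= dens X Y.
Proof. by rewrite divr_ge0 ?edge_sum_ge0 ?mulr_ge0. Qed.

Lemma dens_le1 X Y : dens X Y <= 1.
Proof.
rewrite /dens; have [e|ne] := eqVneq (#|X|%:R * #|Y|%:R : R) 0.
  by rewrite e invr0 mulr0.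
by rewrite ler_pdivrMr ?mul1r ?edge_sum_le // lt0r ne mulr_ge0.
Qed.

Section Energy.
Variables (C : finType) (c : V -> C).

Definition cls a : {set V} := [set v | c v == a].
Definition cdens x y := dens (cls (c x)) (cls (c y)).

Definition energy : R := \sum_x \sum_y cdens x y ^+ 2.

Lemma sum_cls (F : V -> V -> R) :
  \sum_x \sum_y F x y = \sum_a \sum_b \sum_(x in cls a) \sum_(y in cls b) F x y.
Proof.
rewrite (partition_big c xpredT) //=; apply: eq_bigr => a _.
rewrite [RHS]exchange_big /=; apply: eq_big => [x|x _]; first by rewrite inE.
rewrite (partition_big c xpredT) //=; apply: eq_bigr => b _.
by apply: eq_bigl => y; rewrite inE.
Qed.

Lemma in_cls x a : x \in cls a -> c x = a.
Proof. by rewrite inE => /eqP. Qed.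

(* The average of [f] over a cell is the optimal constant in the least square
   approximation: [2 th f - th ^ 2] is maximised at the density. *)
Lemma energy_ge (th : C -> C -> R) :
  \sum_x \sum_y (2 * th (c x) (c y) * f x y - th (c x) (c y) ^+ 2) <= energy.
Proof.
rewrite /energy !sum_cls; apply: ler_sum => a _; apply: ler_sum => b _.
have -> : \sum_(x in cls a) \sum_(y in cls b)
    (2 * th (c x) (c y) * f x y - th (c x) (c y) ^+ 2) =
  2 * th a b * edge_sum (cls a) (cls b) - th a b ^+ 2 * (#|cls a|%:R * #|cls b|%:R).
  rewrite -sum_const2 /edge_sum mulr_sumr -sumrB; apply: eq_bigr => x /in_cls ->.
  by rewrite mulr_sumr -sumrB; apply: eq_bigr => y /in_cls ->.
have -> : \sum_(x in cls a) \sum_(y in cls b) cdens x y ^+ 2 =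
  dens (cls a) (cls b) ^+ 2 * (#|cls a|%:R * #|cls b|%:R).
  rewrite -sum_const2; apply: eq_bigr => x /in_cls cx; apply: eq_bigr => y /in_cls cy.
  by rewrite /cdens cx cy.
rewrite -densK -subr_ge0.
set m := _%:R * _; set d := dens _ _; set t := th a b.
have -> : d ^+ 2 * m - (2 * t * (d * m) - t ^+ 2 * m) = (d - t) ^+ 2 * m by ring.
by rewrite mulr_ge0 ?sqr_ge0 // mulr_ge0.
Qed.

Lemma energyE :
  energy = \sum_x \sum_y (2 * cdens x y * f x y - cdens x y ^+ 2).
Proof.
rewrite /energy !sum_cls; apply: eq_bigr => a _; apply: eq_bigr => b _.
set d := dens (cls a) (cls b).
have -> : \sum_(x in cls a) \sum_(y in cls b)
    (2 * cdens x y * f x y - cdens x y ^+ 2) =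
  2 * d * edge_sum (cls a) (cls b) - d ^+ 2 * (#|cls a|%:R * #|cls b|%:R).
  rewrite -sum_const2 /edge_sum mulr_sumr -sumrB; apply: eq_bigr => x /in_cls cx.
  rewrite mulr_sumr -sumrB; apply: eq_bigr => y /in_cls cy.
  by rewrite /cdens cx cy.
have -> : \sum_(x in cls a) \sum_(y in cls b) cdens x y ^+ 2 =
  d ^+ 2 * (#|cls a|%:R * #|cls b|%:R).
  rewrite -sum_const2; apply: eq_bigr => x /in_cls cx; apply: eq_bigr => y /in_cls cy.
  by rewrite /cdens cx cy.
rewrite -densK -/d; ring.
Qed.

Lemma energy_ge0 : 0 <= energy.
Proof. by apply: sumr_ge0 => x _; apply: sumr_ge0 => y _; rewrite sqr_ge0. Qed.

Lemma energy_le : energy <= #|V|%:R ^+ 2.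
Proof.
have -> : #|V|%:R ^+ 2 = \sum_(x : V) \sum_(y : V) 1 :> R.
  by rewrite !sum_constT mul1r expr2.
apply: ler_sum => x _; apply: ler_sum => y _.
by rewrite expr_le1 ?dens_ge0 ?dens_le1.
Qed.

Definition irregularity (eps : R) : R :=
  \sum_a \sum_(b | ~~ lower_regular eps (cls a) (cls b)) #|cls a|%:R * #|cls b|%:R.

End Energy.

(* Split each class along the witnesses of irregularity of all the pairs it
   belongs to. *)
Lemma refine (C : finType) (c : V -> C) (eps : R) : 0 < eps ->
  exists (D : finType) (c' : V -> D),
    (#|D| = #|C| * (2 ^ #|C| * 2 ^ #|C|))%N /\
    energy c + eps ^+ 4 * irregularity c eps <= energy c'.
Proof.
move=> e0.
pose bad a b (p : {set V} * {set V}) :=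
  [&& p.1 \subset cls c a, p.2 \subset cls c b, eps * #|cls c a|%:R <= #|p.1|%:R,
      eps * #|cls c b|%:R <= #|p.2|%:R &
      edge_sum p.1 p.2 < (dens (cls c a) (cls c b) - eps) * (#|p.1|%:R * #|p.2|%:R)].
pose w a b := odflt (set0, set0) [pick p | bad a b p].
have wP a b : ~~ lower_regular eps (cls c a) (cls c b) -> bad a b (w a b).
  move=> irr; rewrite /w; case: pickP => [p //|none].
  case/negP: irr; apply/forallP => X; apply/forallP => Y; apply/implyP.
  move=> /and4P[h1 h2 h3 h4]; rewrite leNgt; apply/negP => h5.
  by have := none (X, Y); rewrite /bad /= h1 h2 h3 h4 h5.
pose D : finType := (C * ({ffun C -> bool} * {ffun C -> bool}))%type.
pose c' (v : V) : D :=
  (c v, ([ffun b => v \in (w (c v) b).1], [ffun b => v \in (w b (c v)).2])).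
exists D, c'; split; first by rewrite !card_prod !card_ffun card_bool.
pose irr a b := ~~ lower_regular eps (cls c a) (cls c b).
pose th (s t : D) : R := dens (cls c s.1) (cls c t.1) -
   (if [&& irr s.1 t.1, s.2.1 t.1 & t.2.2 s.1] then eps else 0).
apply: le_trans (energy_ge c' th).
rewrite energyE -lerBrDl -sumrB.
under [leRHS]eq_bigr => x _ do rewrite -sumrB.
rewrite (sum_cls c) /irregularity mulr_sumr; apply: ler_sum => a _.
rewrite mulr_sumr big_mkcond /=; apply: ler_sum => b _.
set d := dens (cls c a) (cls c b).
have H x y : x \in cls c a -> y \in cls c b ->
   th (c' x) (c' y) = d - (if [&& irr a b, x \in (w a b).1 & y \in (w a b).2] then eps else 0).
  by move=> /in_cls cx /in_cls cy; rewrite /th /c' /= !ffunE cx cy.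
have [reg|nreg] := boolP (lower_regular eps (cls c a) (cls c b)).
  rewrite /=; apply: sumr_ge0 => x xa; apply: sumr_ge0 => y yb.
  rewrite H // /irr reg /= subr0 /cdens (in_cls xa) (in_cls yb) -/d.
  by rewrite subrr.
rewrite /=; case/and5P: (wP _ _ nreg); set X := (w a b).1; set Y := (w a b).2.
move=> sX sY lX lY lt.
have -> : \sum_(x in cls c a) \sum_(y in cls c b)
    (2 * th (c' x) (c' y) * f x y - th (c' x) (c' y) ^+ 2 -
       (2 * cdens c x y * f x y - cdens c x y ^+ 2)) =
   \sum_(x in X) \sum_(y in Y) (2 * d * eps - eps ^+ 2 - 2 * eps * f x y).
  rewrite (big_setID X) /= (setIidPr sX) [X in _ + X]big1 ?addr0; last first.
    move=> x; rewrite inE => /andP[xX xa]; rewrite big1 // => y yb.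
    rewrite H // -/X -/Y (negbTE xX) andbF subr0 /cdens (in_cls xa) (in_cls yb) -/d.
    by rewrite subrr.
  apply: eq_bigr => x xX; have xa := subsetP sX _ xX.
  rewrite (big_setID Y) /= (setIidPr sY) [X in _ + X]big1 ?addr0; last first.
    move=> y; rewrite inE => /andP[yY yb].
    rewrite H // -/X -/Y (negbTE yY) !andbF subr0 /cdens (in_cls xa) (in_cls yb) -/d.
    by rewrite subrr.
  apply: eq_bigr => y yY; have yb := subsetP sY _ yY.
  rewrite H // -/X -/Y xX yY /irr nreg /= /cdens (in_cls xa) (in_cls yb) -/d; ring.
have -> : \sum_(x in X) \sum_(y in Y) (2 * d * eps - eps ^+ 2 - 2 * eps * f x y) =
   (2 * d * eps - eps ^+ 2) * (#|X|%:R * #|Y|%:R) - 2 * eps * edge_sum X Y.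
  rewrite -sum_const2 /edge_sum mulr_sumr -sumrB; apply: eq_bigr => x _.
  by rewrite mulr_sumr -sumrB.
rewrite -/d in lt.
have XY : eps ^+ 2 * (#|cls c a|%:R * #|cls c b|%:R) <= #|X|%:R * #|Y|%:R.
  have -> : eps ^+ 2 * (#|cls c a|%:R * #|cls c b|%:R)
     = (eps * #|cls c a|%:R) * (eps * #|cls c b|%:R) by ring.
  by apply: ler_pM => //; rewrite mulr_ge0 // ltW.
have e2 : eps ^+ 4 * (#|cls c a|%:R * #|cls c b|%:R) <= eps ^+ 2 * (#|X|%:R * #|Y|%:R).
  rewrite (_ : eps ^+ 4 = eps ^+ 2 * eps ^+ 2); last by ring.
  by rewrite -mulrA ler_wpM2l ?sqr_ge0.
apply: le_trans e2 _; move: lt; set m := _%:R * _; set s := edge_sum _ _ => lt.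
rewrite -subr_ge0.
have -> : (2 * d * eps - eps ^+ 2) * m - 2 * eps * s - eps ^+ 2 * m
   = 2 * eps * ((d - eps) * m - s) by ring.
by rewrite mulr_ge0 ?subr_ge0 ?ltW // mulr_gt0.
Qed.

End Density.

Lemma regularity (R : archiRealFieldType) (eps : R) : 0 < eps ->
  exists K : nat, forall (V : finType) (f : V -> V -> R),
    (forall x y, 0 <= f x y <= 1) ->
  exists (C : finType) (c : V -> C), (#|C| <= K)%N /\
    irregularity f c eps <= eps * #|V|%:R ^+ 2.
Proof.
move=> e0.
have step s : forall k, exists K : nat, forall (V : finType) (f : V -> V -> R)
    (C : finType) (c : V -> C), (forall x y, 0 <= f x y <= 1) -> (#|C| <= k)%N ->
    (1 - s%:R * eps ^+ 5) * #|V|%:R ^+ 2 <= energy f c ->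
  exists (C : finType) (c : V -> C), (#|C| <= K)%N /\
    irregularity f c eps <= eps * #|V|%:R ^+ 2.
  elim: s => [|s IHs] k.
    exists k => V f C c f01 Ck; rewrite mul0r subr0 mul1r => en.
    exists C, c; split=> //.
    have [D [c' [_ en']]] := refine f01 c e0.
    have := le_trans en' (energy_le f01 c').
    move=> h; have {h} h : eps ^+ 4 * irregularity f c eps <= 0 by lra.
    rewrite pmulr_rle0 ?exprn_gt0 // in h; apply: le_trans h _.
    by rewrite mulr_ge0 ?sqr_ge0 // ltW.
  have [K HK] := IHs (k * (2 ^ k * 2 ^ k))%N; exists (maxn k K) => V f C c f01 Ck en.
  have [good|bad] := lerP (irregularity f c eps) (eps * #|V|%:R ^+ 2).
    by exists C, c; split=> //; rewrite leq_max Ck.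
  have [D [c' [cD en']]] := refine f01 c e0.
  have [] := HK V f D c' f01.
  - by rewrite cD !leq_mul // leq_exp2l.
  - apply: le_trans en'.
    have : eps ^+ 4 * (eps * #|V|%:R ^+ 2) <= eps ^+ 4 * irregularity f c eps.
      by rewrite ler_wpM2l ?exprn_ge0 ?ltW // ltW.
    rewrite -natr1 in en; rewrite mulrA -exprSr; lra.
  by move=> C' [c'' [h1 h2]]; exists C', c''; split=> //; rewrite leq_max h1 orbT.
have [K HK] := step (Num.Def.archi_bound (eps ^- 5)) 1%N.
exists K => V f f01; apply: (HK V f unit (fun=> tt) f01); first by rewrite card_unit.
apply: le_trans (energy_ge0 _ _); rewrite mulr_le0_ge0 ?sqr_ge0 //.
have := archi_boundP (ltW (_ : 0 < eps ^- 5)); rewrite invr_gt0 exprn_gt0 // => /(_ isT).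
rewrite -(ltr_pM2r (exprn_gt0 5 e0)) mulVf ?gt_eqF ?exprn_gt0 //; lra.
Qed.

(** * The weighted Lagrangian *)

Section Lagrangian.
Variables (R : realFieldType) (C : finType) (r f : rel C).
Hypothesis r_sym : symmetric r.
Hypothesis f_sym : symmetric f.
(* Repetitions are allowed, so this also excludes loops. *)
Hypothesis r_noK4 : forall a b c d,
  ~~ [&& r a b, r a c, r a d, r b c, r b d & r c d].
Hypothesis f_noK3 : forall a b c, ~~ [&& f a b, f a c & f b c].

Let w a b : R := (r a b)%:R * (3 / 4 + (f a b)%:R / 4).
Let Q (x : C -> R) : R := \sum_a \sum_b w a b * x a * x b.

Let w_sym a b : w a b = w b a.
Proof. by rewrite /w r_sym f_sym. Qed.

Let w_diag a : w a a = 0.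
Proof.
have := r_noK4 a a a a; rewrite /w; case: (r a a) => //=.
by rewrite mul0r.
Qed.

Let w_le1 a b : w a b <= 1.
Proof. by rewrite /w; case: (r a b); case: (f a b) => /=; lra. Qed.

Let w_le34 a b c : [\/ w a b <= 3 / 4, w a c <= 3 / 4 | w b c <= 3 / 4].
Proof.
have := f_noK3 a b c; rewrite /w.
case: (f a b) => /=; last by move=> _; constructor 1; case: (r a b); rewrite /=; lra.
case: (f a c) => /=; last by move=> _; constructor 2; case: (r a c); rewrite /=; lra.
by case: (f b c) => //= _; constructor 3; case: (r b c); rewrite /=; lra.
Qed.

Let Qsplit (x : C -> R) i : Q x = 2 * x i * (\sum_(b | b != i) w i b * x b) +
  \sum_(a | a != i) \sum_(b | b != i) w a b * x a * x b.
Proof.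
rewrite /Q (bigD1 i) //= (bigD1 i) //= w_diag !mul0r add0r.
have -> : \sum_(a | a != i) \sum_b w a b * x a * x b = \sum_(a | a != i) w a i * x a * x i
   + \sum_(a | a != i) \sum_(b | b != i) w a b * x a * x b.
  by rewrite -big_split; apply: eq_bigr => a ai; rewrite (bigD1 i).
rewrite addrA; congr (_ + _); rewrite -mulrA mulr_sumr.
rewrite mulr_sumr -big_split /=; apply: eq_bigr => b bi; rewrite (w_sym b i); ring.
Qed.

Let tri (a b c x y z : R) : 0 <= x -> 0 <= y -> 0 <= z ->
  a <= 1 -> b <= 1 -> c <= 3 / 4 ->
  2 * (a * (x * y) + b * (y * z) + c * (x * z)) <= 8 / 13 * (x + y + z) ^+ 2.
Proof.
move=> x0 y0 z0 a1 b1 c1.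
have h1 : a * (x * y) <= 1 * (x * y) by rewrite ler_wpM2r // mulr_ge0.
have h2 : b * (y * z) <= 1 * (y * z) by rewrite ler_wpM2r // mulr_ge0.
have h3 : c * (x * z) <= 3 / 4 * (x * z) by rewrite ler_wpM2r // mulr_ge0.
have h4 : 0 <= (4 * y - 5 * (x + z) / 2) ^+ 2 by rewrite sqr_ge0.
have h5 : 0 <= (x - z) ^+ 2 by rewrite sqr_ge0.
nra.
Qed.

Let Q3 (x : C -> R) a b c : (forall i, 0 <= x i) -> uniq [:: a; b; c] ->
  (forall i, i \notin [:: a; b; c] -> x i = 0) ->
  Q x <= 8 / 13 * (\sum_i x i) ^+ 2.
Proof.
move=> x0 u supp.
have red (F : C -> R) : (forall i, x i = 0 -> F i = 0) -> \sum_i F i = F a + F b + F c.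
  move=> F0; rewrite (bigID (mem [:: a; b; c])) /= [X in _ + X]big1 ?addr0; last first.
    by move=> i /supp /F0.
  by rewrite -big_uniq //= !big_cons big_nil addr0 addrA.
rewrite (red x) // /Q (red (fun i => \sum_j w i j * x i * x j)); last first.
  by move=> i xi; rewrite big1 // => j _; rewrite xi mulr0 mul0r.
have redw i : \sum_j w i j * x i * x j =
    w i a * x i * x a + w i b * x i * x b + w i c * x i * x c.
  by rewrite (red (fun j => w i j * x i * x j)) // => j ->; rewrite mulr0.
rewrite !redw.
rewrite !w_diag (w_sym b a) (w_sym c a) (w_sym c b).
have [h|h|h] := w_le34 a b c.
- have := tri (x0 b) (x0 c) (x0 a) (w_le1 b c) (w_le1 a c) h; nra.
- have := tri (x0 a) (x0 b) (x0 c) (w_le1 a b) (w_le1 b c) h; nra.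
- have := tri (x0 b) (x0 a) (x0 c) (w_le1 a b) (w_le1 a c) h; nra.
Qed.

(* Symmetrisation: moving all the weight of one of two non-adjacent vertices to
   the better of the two does not decrease the form, which is linear along this
   move, and shrinks the support; a clique in the support has order at most 3. *)
Lemma lagrangian (x : C -> R) : (forall a, 0 <= x a) ->
  \sum_a \sum_b (r a b)%:R * (3 / 4 + (f a b)%:R / 4) * x a * x b
    <= 8 / 13 * (\sum_a x a) ^+ 2.
Proof.
rewrite -/(Q x).
move: {2}#|_|.+1 (ltnSn #|[set a | x a != 0]|) => m.
elim: m x => // m IH x sm x0; rewrite ltnS in sm.
pose S := [set a | x a != 0].
have [|nc] := boolP [forall i in S, forall j in S, (i != j) ==> r i j]; last first.
  case/forall_inPn: nc => i iS /forall_inPn[j jS]; rewrite negb_imply => /andP[ij nr].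
  wlog le : i j iS jS ij nr / \sum_(b | (b != i) && (b != j)) w j b * x b
      <= \sum_(b | (b != i) && (b != j)) w i b * x b.
    move=> W; have [|/ltW] := lerP (\sum_(b | (b != i) && (b != j)) w j b * x b)
      (\sum_(b | (b != i) && (b != j)) w i b * x b); first exact: W.
    move=> h; apply: (W j i) => //; rewrite 1?eq_sym // 1?r_sym //.
    under eq_bigl do rewrite andbC.
    by under [leRHS]eq_bigl do rewrite andbC.
  have wij : w i j = 0 by rewrite /w (negbTE nr) mul0r.
  pose x' a := if a == i then x i + x j else if a == j then 0 else x a.
  have x'i : x' i = x i + x j by rewrite /x' eqxx.
  have x'j : x' j = 0 by rewrite /x' eq_sym (negbTE ij) eqxx.
  have x'E a : a != i -> a != j -> x' a = x a.
    by move=> ai aj; rewrite /x' (negbTE ai) (negbTE aj).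
  have x'0 a : 0 <= x' a by rewrite /x'; case: eqP => _; [rewrite addr_ge0|case: eqP].
  have sum' : \sum_a x' a = \sum_a x a.
    rewrite (bigD1 i) // (bigD1 j) 1?eq_sym //= [RHS](bigD1 i) // [in RHS](bigD1 j) 1?eq_sym //=.
    rewrite x'i x'j add0r addrA; congr (_ + _); apply: eq_bigr => a /andP[ai aj].
    exact: x'E.
  have Q2 (y : C -> R) : Q y = 2 * y i * (\sum_(b | (b != i) && (b != j)) w i b * y b) +
     2 * y j * (\sum_(b | (b != i) && (b != j)) w j b * y b) +
     \sum_(a | (a != i) && (a != j)) \sum_(b | (b != i) && (b != j)) w a b * y a * y b.
    rewrite (Qsplit _ i) (bigD1 j) 1?eq_sym //= wij mul0r add0r -addrA; congr (_ + _).
    rewrite (bigD1 j) 1?eq_sym //= (bigD1 j) 1?eq_sym //= w_diag !mul0r add0r.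
    have -> : \sum_(a | (a != i) && (a != j)) \sum_(b | b != i) w a b * y a * y b =
      \sum_(a | (a != i) && (a != j)) w a j * y a * y j +
      \sum_(a | (a != i) && (a != j)) \sum_(b | (b != i) && (b != j)) w a b * y a * y b.
      rewrite -big_split; apply: eq_bigr => a /andP[ai aj].
      by rewrite (bigD1 j) 1?eq_sym.
    rewrite addrA; congr (_ + _); rewrite -mulrA mulr_sumr.
    rewrite mulr_sumr -big_split /=; apply: eq_bigr => b bi; rewrite (w_sym b j); ring.
  have -> : (\sum_a x a) = \sum_a x' a by [].
  apply: le_trans (IH x' _ x'0).
    rewrite !Q2 x'i x'j.
    have -> : \sum_(b | (b != i) && (b != j)) w i b * x' b =
       \sum_(b | (b != i) && (b != j)) w i b * x b.
      by apply: eq_bigr => b /andP[bi bj]; rewrite x'E.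
    have -> : \sum_(a | (a != i) && (a != j)) \sum_(b | (b != i) && (b != j)) w a b * x' a * x' b =
      \sum_(a | (a != i) && (a != j)) \sum_(b | (b != i) && (b != j)) w a b * x a * x b.
      apply: eq_bigr => a /andP[ai aj]; apply: eq_bigr => b /andP[bi bj].
      by rewrite !x'E.
    move: le; set A := \sum_(b | _) w j b * _; set B := \sum_(b | _) w i b * _.
    set D := \sum_(a | _) _ => le; have := ler_wpM2l (x0 j) le; lra.
  apply: leq_trans sm; apply: proper_card; apply/properP; split.
    apply/subsetP => a; rewrite !inE /x'; case: (a =P i) => [->|_].
      by move: iS; rewrite inE.
    by case: (a =P j) => //; rewrite eqxx.
  by exists j => //; rewrite inE x'j eqxx.
move=> cl.
have cl2 i j : i \in S -> j \in S -> i != j -> r i j.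
  by move=> iS jS; move/forall_inP: cl => /(_ i iS) /forall_inP /(_ j jS) /implyP.
have supp (s : seq C) : S =i s -> forall i, i \notin s -> x i = 0.
  by move=> e i; rewrite -e inE negbK => /eqP.
have [s us eS] : exists2 s, uniq s & S =i s.
  by exists (enum S); [exact: enum_uniq | move=> i; rewrite mem_enum].
case: s us eS => [|a [|b [|c [|d s]]]] us eS.
- rewrite /Q big1; first by rewrite mulr_ge0 ?sqr_ge0 ?divr_ge0.
  by move=> i _; rewrite big1 // => j _; rewrite (supp _ eS) // mulr0 mul0r.
- have x1 i : i != a -> x i = 0 by move=> ia; apply: (supp _ eS); rewrite inE.
  rewrite (Qsplit x a) big1 => [|i ia]; last by rewrite x1 // mulr0.
  rewrite mulr0 add0r big1 => [|i ia]; first by rewrite mulr_ge0 ?sqr_ge0 ?divr_ge0.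
  by rewrite big1 // => j ja; rewrite (x1 j) // mulr0.
- have x2 i : i != a -> i != b -> x i = 0.
    by move=> ia ib; apply: (supp _ eS); rewrite !inE negb_or ia.
  have ab : b != a by move: us; rewrite /= !inE andbT eq_sym.
  rewrite (Qsplit x a) (bigD1 b) //= big1 ?addr0; last first.
    by move=> i /andP[ia ib]; rewrite x2 ?mulr0.
  rewrite big1 ?addr0; last first.
    move=> i ia; rewrite (bigD1 b) //= big1; last first.
      by move=> j /andP[ja jb]; rewrite (x2 j) ?mulr0.
    have [->|ib] := eqVneq i b; first by rewrite w_diag !mul0r addr0.
    by rewrite (x2 i) // mulr0 mul0r addr0.
  have -> : \sum_i x i = x a + x b.
    rewrite (bigD1 a) //= (bigD1 b) //= [X in _ + (_ + X)]big1 ?addr0 //.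
    by move=> i /andP[]; exact: x2.
  have := w_le1 a b; have := ler_wpM2r (mulr_ge0 (x0 a) (x0 b)) (w_le1 a b).
  have : 0 <= (x a - x b) ^+ 2 by rewrite sqr_ge0.
  have := mulr_ge0 (x0 a) (x0 b).
  nra.
- exact: Q3 (supp _ eS).
- exfalso; have := r_noK4 a b c d; rewrite !cl2 //.
  all: rewrite ?eS ?inE ?eqxx ?orbT //.
  all: move: us; rewrite /= !inE !negb_or => /and5P[/and4P[? ? ? _] /and3P[? ? _] /andP[? _] _ _] //.
Qed.

End Lagrangian.

(** * Cliques and dependent random choice *)

Section Clique.
Variables (V : finType) (e : rel V).

Definition clique (S : {set V}) : bool :=
  [forall x in S, forall y in S, (x != y) ==> e x y].

Definition has_clique (k : nat) (S : {set V}) : bool :=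
  [exists Q : {set V}, [&& Q \subset S, #|Q| == k & clique Q]].

Definition joined (A B : {set V}) : bool := [forall x in A, forall y in B, e x y].

Lemma cliqueP (S : {set V}) :
  reflect {in S &, forall x y, x != y -> e x y} (clique S).
Proof.
apply: (iffP forall_inP) => [h x y xS yS xy|h x xS].
  by have /forall_inP/(_ y yS)/implyP := h x xS; apply.
by apply/forall_inP => y yS; apply/implyP => xy; apply: h.
Qed.

Lemma joinedP (A B : {set V}) :
  reflect (forall x y, x \in A -> y \in B -> e x y) (joined A B).
Proof.
apply: (iffP forall_inP) => [h x y xS yS|h x xS].
  by have /forall_inP/(_ y yS) := h x xS.
by apply/forall_inP => y yS; apply: h.
Qed.

Lemma has_cliqueP (k : nat) (S : {set V}) :
  reflect (exists Q : {set V}, [/\ Q \subset S, #|Q| = k & clique Q]) (has_clique k S).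
Proof.
apply: (iffP existsP) => -[Q]; first by case/and3P => QS /eqP cQ clQ; exists Q.
by case=> QS cQ clQ; exists Q; rewrite QS cQ eqxx.
Qed.

Hypothesis e_sym : symmetric e.
Hypothesis e_irr : irreflexive e.

Lemma clique_join (A B : {set V}) : clique A -> clique B -> joined A B ->
  clique (A :|: B) /\ #|A :|: B| = (#|A| + #|B|)%N.
Proof.
move=> /cliqueP cA /cliqueP cB /joinedP j; split.
  apply/cliqueP => x y; rewrite !inE => /orP[] xA /orP[] yA xy.
  - exact: cA.
  - exact: j.
  - by rewrite e_sym; apply: j.
  - exact: cB.
rewrite cardsU (_ : A :&: B = set0) ?cards0 ?subn0 //; apply/setP => x.
by rewrite !inE; apply/negP => /andP[xA xB]; have := j x x xA xB; rewrite e_irr.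
Qed.

Lemma joinedU (A B D : {set V}) : joined A D -> joined B D -> joined (A :|: B) D.
Proof.
move=> /joinedP h1 /joinedP h2; apply/joinedP => x y; rewrite inE => /orP[] h yD.
  exact: h1.
exact: h2.
Qed.

(* A maximal independent subset I of S dominates S, and each neighbourhood
   is independent if S is triangle-free. *)
Lemma triangle_of_large (a : nat) (S : {set V}) :
  (forall I : {set V}, {in I &, forall x y, ~~ e x y} -> (#|I| <= a)%N) ->
  (a + a * a < #|S|)%N -> has_clique 3 S.
Proof.
move=> ind lt; apply: contraLR lt => noK3; rewrite -leqNgt.
have nbr x (T : {set V}) : x \in S -> T \subset S -> (#|[set y in T | e x y]| <= a)%N.
  move=> xS TS; apply: ind => y z; rewrite !inE => /andP[yT xy] /andP[zT xz].
  apply: contra noK3 => yz; apply/has_cliqueP; exists [set x; y; z].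
  have nxy : x != y by apply: contraTneq xy => ->; rewrite e_irr.
  have nxz : x != z by apply: contraTneq xz => ->; rewrite e_irr.
  have nyz : y != z by apply: contraTneq yz => ->; rewrite e_irr.
  split.
  - apply/subsetP => u; rewrite !inE => /orP[/orP[]|] /eqP-> //; exact: (subsetP TS).
  - by rewrite -setUA cardsU1 cards2 !inE negb_or nxy nxz nyz.
  apply/cliqueP => u v; rewrite !inE => /orP[/orP[]|]/eqP-> /orP[/orP[]|]/eqP->;
    by rewrite ?eqxx // e_sym.
pose ok (I : {set V}) := (I \subset S) && [forall x in I, forall y in I, ~~ e x y].
have ok0 : ok set0 by rewrite /ok sub0set /=; apply/forall_inP => x; rewrite inE.
have [I /maxsetP[/andP[IS /forall_inP iI] maxI] _] := maxset_exists ok0.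
have iI2 : {in I &, forall x y, ~~ e x y}.
  by move=> x y xI yI; have /forall_inP/(_ y yI) := iI x xI.
have cov : S \subset I :|: \bigcup_(x in I) [set y in S | e x y].
  apply/subsetP => y yS; rewrite inE; apply/orP.
  have [yI|yI] := boolP (y \in I); [by left|right].
  apply/bigcupP; have [/exists_inP[x xI xy]|no] := boolP [exists x in I, e x y].
    by exists x => //; rewrite inE yS.
  case/negP: yI; rewrite -(maxI (y |: I)) ?setU11 ?subsetU1 //.
  apply/andP; split; first by rewrite subUset sub1set yS.
  have no2 x : x \in I -> ~~ e x y.
    by move=> xI; apply: contra no => xy; apply/exists_inP; exists x.
  apply/forall_inP => u; rewrite !inE => /predU1P[->|uI];
    apply/forall_inP => v; rewrite !inE => /predU1P[->|vI]; rewrite ?e_irr //.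
  - by rewrite e_sym no2.
  - exact: no2.
  - exact: iI2.
apply: leq_trans (subset_leq_card cov) _; apply: leq_trans (leq_card_setU _ _) _.
apply: leq_add; first exact: ind.
apply: (@leq_trans (\sum_(x in I) a)%N).
  apply: (@leq_trans (\sum_(x in I) #|[set y in S | e x y]|)%N).
    by elim/big_rec2: _ => [|x m A xI IH]; rewrite ?cards0 //;
       apply: leq_trans (leq_card_setU _ _) _; rewrite leq_add2l.
  by apply: leq_sum => x xI; apply: nbr => //; apply: (subsetP IS).
by rewrite sum_nat_const leq_mul2r ind ?orbT.
Qed.

End Clique.

Section DependentRandomChoice.
Variable R : realFieldType.

Lemma expr_tangent (t : nat) (a x : R) : 0 <= a -> 0 <= x ->
  a ^+ t.+1 + t.+1%:R * a ^+ t * (x - a) <= x ^+ t.+1.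
Proof.
move=> a0 x0; elim: t => [|t IH]; first by rewrite expr0 !expr1; lra.
have {}IH := ler_wpM2l x0 IH.
rewrite -exprS in IH; apply: le_trans IH; rewrite -subr_ge0.
have -> : x * (a ^+ t.+1 + t.+1%:R * a ^+ t * (x - a)) -
  (a ^+ t.+2 + t.+2%:R * a ^+ t.+1 * (x - a)) = t.+1%:R * a ^+ t * (x - a) ^+ 2.
  rewrite !exprS -[t.+2%:R]natr1; ring.
by rewrite mulr_ge0 ?sqr_ge0 // mulr_ge0 // exprn_ge0.
Qed.

Lemma power_mean (I : finType) (d : I -> R) (a : R) (t : nat) : 0 <= a ->
  (forall i, 0 <= d i) -> a * #|I|%:R <= \sum_i d i ->
  a ^+ t * #|I|%:R <= \sum_i d i ^+ t.
Proof.
move=> a0 d0 h; case: t => [|t].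
  by rewrite expr0 -sum_constT; apply: ler_sum => i _; rewrite expr0.
apply: (@le_trans _ _ (\sum_i (a ^+ t.+1 + t.+1%:R * a ^+ t * (d i - a)))).
  rewrite big_split /= sum_constT lerDl -mulr_sumr mulr_ge0 //.
    by rewrite mulr_ge0 // exprn_ge0.
  by rewrite sumrB sum_constT subr_ge0.
by apply: ler_sum => i _; apply: expr_tangent.
Qed.

Lemma leq_bin_exp (n k : nat) : ('C(n, k) <= n ^ k)%N.
Proof.
apply: (@leq_trans (n ^_ k)); first by rewrite -bin_ffact leq_pmulr ?fact_gt0.
by elim: k => // k IH; rewrite ffactnSr expnSr leq_mul // leq_subr.
Qed.

Definition common (V B : finType) (N : V -> {set B}) (Q : {set V}) : {set B} :=
  [set b | [forall v in Q, b \in N v]].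

Lemma commonP (V B : finType) (N : V -> {set B}) (Q : {set V}) b :
  reflect (forall v, v \in Q -> b \in N v) (b \in common N Q).
Proof. by rewrite inE; apply: forall_inP. Qed.

(* The expected number of common neighbours of [t] random elements of [B] is at
   least [p ^ t n], while at most [mu ^ t n ^ 3] of the triples they contain have
   few common neighbours; delete one vertex from each of the latter. *)
Lemma dependent_random_choice (V B : finType) (e : rel V) (N : V -> {set B})
    (p mu h : R) (t : nat) :
  (0 < #|B|)%N -> 0 <= p -> 0 <= mu ->
  p * #|V|%:R * #|B|%:R <= \sum_v #|N v|%:R ->
  h <= p ^+ t * #|V|%:R - mu ^+ t * #|V|%:R ^+ 3 ->
  (forall S : {set V}, h <= #|S|%:R -> has_clique e 3 S) ->
  exists Q : {set V}, [/\ #|Q| = 3%N, clique e Q & mu * #|B|%:R <= #|common N Q|%:R].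
Proof.
move=> B0 p0 mu0 hN hh K3.
have card_ffunI (S : {set B}) : #|[pred g : {ffun 'I_t -> B} | g \in ffun_on (mem S)]|
    = (#|S| ^ t)%N by rewrite card_ffun_on card_ord.
pose U (g : {ffun 'I_t -> B}) := [set v | [forall i, g i \in N v]].
pose bad (Q : {set V}) := (#|Q| == 3%N) && (#|common N Q|%:R < mu * #|B|%:R).
pose nb g := #|[set Q : {set V} | bad Q && (Q \subset U g)]|.
have sumU : (p * #|B|%:R) ^+ t * #|V|%:R <= \sum_g #|U g|%:R.
  have -> : \sum_g #|U g|%:R = \sum_v #|N v|%:R ^+ t :> R.
    under eq_bigr => g _ do rewrite -sum1_card natr_sum big_mkcond /=.
    rewrite exchange_big /=; apply: eq_bigr => v _.
    rewrite -natrX -card_ffunI.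
    rewrite -sum1_card natr_sum [RHS]big_mkcond /=; apply: eq_bigr => g _; rewrite inE.
    by congr (if _ then _ else _); apply/forallP/ffun_onP => H i; apply: H.
  apply: power_mean => //; first by rewrite mulr_ge0.
  by move: hN; rewrite mulrAC.
have sumb : \sum_g (nb g)%:R <= (mu * #|B|%:R) ^+ t * #|V|%:R ^+ 3.
  have -> : \sum_g (nb g)%:R = \sum_(Q | bad Q) #|common N Q|%:R ^+ t :> R.
    under eq_bigr => g _ do rewrite /nb -sum1_card natr_sum big_mkcond /=.
    rewrite exchange_big [RHS]big_mkcond /=; apply: eq_bigr => Q _.
    have [bQ|nQ] := boolP (bad Q); last by rewrite big1 // => g _; rewrite inE (negbTE nQ).
    rewrite -natrX -card_ffunI.
    rewrite -sum1_card natr_sum [RHS]big_mkcond /=; apply: eq_bigr => g _; rewrite inE bQ /=.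
    congr (if _ then _ else _); apply/subsetP/ffun_onP => H i.
      by apply/commonP => v /H; rewrite inE => /forallP.
    move=> iQ; rewrite inE; apply/forallP => j.
    by have /commonP := H j; apply.
  apply: (@le_trans _ _ (\sum_(Q : {set V} | bad Q) (mu * #|B|%:R) ^+ t)).
    apply: ler_sum => Q /andP[_ /ltW h1]; rewrite lerXn2r // nnegrE ?mulr_ge0 //.
  rewrite sumr_const -[leLHS]mulr_natr ler_wpM2l ?exprn_ge0 ?mulr_ge0 // -natrX ler_nat.
  apply: leq_trans (leq_bin_exp _ _); rewrite -card_draws.
  by apply: subset_leq_card; apply/subsetP => Q; rewrite !inE => /andP[].
have [g hg] : exists g, h <= #|U g|%:R - (nb g)%:R.
  apply/existsP; apply/contraT; rewrite negb_exists => /forallP no.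
  have : \sum_g (#|U g|%:R - (nb g)%:R) < \sum_(g : {ffun 'I_t -> B}) h.
    apply: ltr_sum => [|g _]; last by rewrite ltNge no.
    apply/hasP; exists ([ffun=> enum_val (Ordinal B0)] : {ffun 'I_t -> B}) => //.
  rewrite sumrB sum_constT card_ffun card_ord natrX ltNge; case/negP.
  have B1 : 0 <= #|B|%:R ^+ t :> R by rewrite exprn_ge0.
  have := ler_wpM2r B1 hh; rewrite !exprMn in sumU sumb; lra.
pose badU := [set Q : {set V} | bad Q && (Q \subset U g)].
pose D := [set v | [exists Q in badU, [pick u in Q] == Some v]].
have cD : (#|D| <= nb g)%N.
  have inj : injective (@Some V) by move=> u v [].
  rewrite -(card_imset (mem D) inj).
  apply: leq_trans (leq_imset_card (fun Q : {set V} => [pick u in Q]) badU).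
  apply: subset_leq_card; apply/subsetP => _ /imsetP[v + ->].
  by rewrite inE => /exists_inP[Q QB /eqP <-]; apply: imset_f.
have : h <= #|U g :\: D|%:R.
  apply: le_trans hg _; rewrite lerBlDr -natrD ler_nat -(cardsID D (U g)) addnC.
  by rewrite leq_add2l (leq_trans _ cD) // subset_leq_card // subsetIr.
move=> /K3 /has_cliqueP[Q [QU cQ clQ]]; exists Q; split=> //.
rewrite leNgt; apply/negP => ltQ.
have QB : Q \in badU.
  by rewrite inE /bad cQ eqxx ltQ /= (subset_trans QU) // subsetDl.
have [v pv] : exists v, [pick u in Q] = Some v.
  case: pickP => [v _|no]; first by exists v.
  by move: cQ; rewrite (eq_card0 no).
have vQ : v \in Q by move: pv; case: pickP => // u uQ [<-].
have := subsetP QU _ vQ; rewrite !inE => /andP[/negP[]]; apply/exists_inP.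
by exists Q => //; rewrite pv.
Qed.

End DependentRandomChoice.

Section ManyK4.
Variable R : realFieldType.

Definition slice (V B : finType) (T : {set V * B}) (x : V) : {set B} :=
  [set b | (x, b) \in T].

Lemma sum_slice (V B : finType) (T : {set V * B}) :
  (\sum_x #|slice T x|)%N = #|T|.
Proof.
rewrite -sum1_card [RHS]big_mkcond [RHS](eq_bigr (fun p => ((p.1, p.2) \in T) : nat)); last first.
  by move=> [x b] _ /=; case: (_ \in T).
rewrite -(pair_bigA _ (fun x b => ((x, b) \in T) : nat)) /=; apply: eq_bigr => x _.
rewrite -sum1_card big_mkcond /=; apply: eq_bigr => b _.
by rewrite [b \in _]inE; case: ((x, b) \in T).
Qed.

Lemma drc_step (V B : finType) (e : rel V) (w : R) (M a t : nat) (T : {set V * B}) :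
  1 <= w -> #|V|%:R = w ^+ (40 * M) -> (a * t)%N = M -> (0 < #|B|)%N ->
  #|V|%:R * #|B|%:R <= w ^+ a * #|T|%:R ->
  (forall S : {set V}, w ^+ (39 * M) - 1 <= #|S|%:R -> has_clique e 3 S) ->
  exists Q : {set V}, [/\ #|Q| = 3%N, clique e Q &
    #|B|%:R <= w ^+ (120 * a) * #|common (slice T) Q|%:R].
Proof.
move=> w1 hn hM B0 hT K3.
have w0 : 0 < w by apply: lt_le_trans w1.
have wn k : w ^+ k != 0 by rewrite gt_eqF // exprn_gt0.
have [||||Q [cQ clQ hQ]] := @dependent_random_choice R V B e (slice T) (w ^- a) (w ^- (120 * a))
  (w ^+ (39 * M) - 1) t B0 _ _ _ _ K3.
- by rewrite invr_ge0 exprn_ge0 // ltW.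
- by rewrite invr_ge0 exprn_ge0 // ltW.
- by rewrite -natr_sum sum_slice -mulrA ler_pdivrMl // exprn_gt0.
- rewrite hn !exprVn -!exprM -mulnA hM.
  have -> : (40 * M * 3 = 120 * M)%N by lia.
  have -> : (40 * M = M + 39 * M)%N by lia.
  by rewrite mulVf // exprD mulKf.
by exists Q; split=> //; rewrite -ler_pdivrMl // exprn_gt0.
Qed.

Lemma clique12_of_many_K4 (V : finType) (e : rel V) (w : R) (M : nat) :
  symmetric e -> irreflexive e -> M = (120 * (120 * 120))%N ->
  1 <= w -> #|V|%:R = w ^+ (40 * M) ->
  #|V|%:R ^+ 4 <= w * #|[set q : V * (V * (V * V)) |
    [&& e q.1 q.2.1, e q.1 q.2.2.1, e q.1 q.2.2.2, e q.2.1 q.2.2.1, e q.2.1 q.2.2.2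
      & e q.2.2.1 q.2.2.2]]|%:R ->
  (forall S : {set V}, w ^+ (39 * M) - 1 <= #|S|%:R -> has_clique e 3 S) ->
  has_clique e 12 [set: V].
Proof.
move=> es ei hM w1 hn; set T0 := [set q | _] => hT0 K3.
have w0 : 0 < w by apply: lt_le_trans w1.
have V0 : (0 < #|V|)%N by rewrite -(ltr_nat R) hn exprn_gt0.
have [|||Q1 [c1 k1 h1]] := @drc_step V _ e w M 1 M T0 w1 hn _ _ _ K3.
- by rewrite mul1n.
- by rewrite !card_prod !muln_gt0 V0.
- rewrite expr1; apply: le_trans hT0; rewrite !card_prod !natrM.
  by rewrite !mulrA -!expr2 -exprSr -exprSr.
set T1 := common _ _ in h1.
have [|||Q2 [c2 k2 h2]] := @drc_step V _ e w M 120 (120 * 120) T1 w1 hn _ _ _ K3.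
- by rewrite hM.
- by rewrite !card_prod !muln_gt0 V0.
- by move: h1; rewrite muln1 card_prod natrM.
set T2 := common _ _ in h2.
have [|||Q3 [c3 k3 h3]] := @drc_step V _ e w M (120 * 120) 120 T2 w1 hn _ _ _ K3.
- by rewrite hM mulnC.
- by rewrite V0.
- by move: h2; rewrite card_prod natrM.
set T3 := common _ _ in h3.
have [|Q4 [s4 c4 k4]] := has_cliqueP _ _ _ (K3 T3 _).
  move: h3; rewrite -hM hn (_ : (40 * M = M + 39 * M)%N); last by lia.
  rewrite exprD ler_pM2l ?exprn_gt0 // => h3; apply: le_trans h3.
  by rewrite gerBl.
have H1 x p : x \in Q1 -> p \in T1 -> (x, p) \in T0.
  by move=> xQ /commonP/(_ x xQ); rewrite inE.
have H2 x p : x \in Q2 -> p \in T2 -> (x, p) \in T1.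
  by move=> xQ /commonP/(_ x xQ); rewrite inE.
have H3 x p : x \in Q3 -> p \in T3 -> (x, p) \in T2.
  by move=> xQ /commonP/(_ x xQ); rewrite inE.
have H x y z u : x \in Q1 -> y \in Q2 -> z \in Q3 -> u \in Q4 ->
  [&& e x y, e x z, e x u, e y z, e y u & e z u].
  move=> xQ yQ zQ uQ; have := H1 x (y, (z, u)) xQ (H2 y (z, u) yQ (H3 z u zQ (subsetP s4 _ uQ))).
  by rewrite inE.
have ex (Q : {set V}) : #|Q| = 3%N -> exists x, x \in Q.
  by move=> cQ; apply/set0Pn; rewrite -card_gt0 cQ.
have [x1 x1Q] := ex _ c1; have [x2 x2Q] := ex _ c2; have [x3 x3Q] := ex _ c3.
have [x4 x4Q] := ex _ c4.
have j12 : joined e Q1 Q2.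
  by apply/joinedP => x y xQ yQ; case/and5P: (H x y x3 x4 xQ yQ x3Q x4Q).
have j13 : joined e Q1 Q3.
  by apply/joinedP => x y xQ yQ; case/and5P: (H x x2 y x4 xQ x2Q yQ x4Q).
have j14 : joined e Q1 Q4.
  by apply/joinedP => x y xQ yQ; case/and5P: (H x x2 x3 y xQ x2Q x3Q yQ).
have j23 : joined e Q2 Q3.
  by apply/joinedP => x y xQ yQ; case/and5P: (H x1 x y x4 x1Q xQ yQ x4Q).
have j24 : joined e Q2 Q4.
  by apply/joinedP => x y xQ yQ; case/and5P: (H x1 x x3 y x1Q xQ x3Q yQ) => _ _ _ _ /andP[].
have j34 : joined e Q3 Q4.
  by apply/joinedP => x y xQ yQ; case/and5P: (H x1 x2 x y x1Q x2Q xQ yQ) => _ _ _ _ /andP[].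
have [l12 n12] := clique_join es ei k1 k2 j12.
have [l123 n123] := clique_join es ei l12 k3 (joinedU j13 j23).
have [l n] := clique_join es ei l123 k4 (joinedU (joinedU j14 j24) j34).
apply/has_cliqueP; exists (Q1 :|: Q2 :|: Q3 :|: Q4); split=> //.
by rewrite n n123 n12 c1 c2 c3 c4.
Qed.

End ManyK4.

(** * Embedding cliques in the reduced graph *)

Section Embedding.
Variables (R : realFieldType) (V : finType) (e : rel V).
Let f (x y : V) : R := (e x y)%:R.

Definition nbrs (x : V) (Y : {set V}) : {set V} := [set y in Y | e x y].

Lemma edge_sum_nbrs (X Y : {set V}) : edge_sum f X Y = \sum_(x in X) #|nbrs x Y|%:R.
Proof.
apply: eq_bigr => x _; rewrite -sum1_card natr_sum.
rewrite [LHS]big_mkcond [RHS]big_mkcond /=; apply: eq_bigr => y _.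
by rewrite inE /f; case: (y \in Y); case: (e x y).
Qed.

Lemma few_atypical (eps dl : R) (X Y Y' : {set V}) : 0 <= eps ->
  lower_regular f eps X Y -> dl <= dens f X Y - eps ->
  Y' \subset Y -> eps * #|Y|%:R <= #|Y'|%:R ->
  #|[set x in X | #|nbrs x Y'|%:R < dl * #|Y'|%:R]|%:R <= eps * #|X|%:R.
Proof.
move=> e0 reg dle sY lY; set B := [set x in X | _].
rewrite leNgt; apply/negP => lt.
have sB : B \subset X by apply/subsetP => x; rewrite inE => /andP[].
move/forallP/(_ B)/forallP/(_ Y')/implyP: reg; rewrite sB sY lY (ltW lt) => /(_ isT).
apply/negP; rewrite -ltNge edge_sum_nbrs.
apply: (@lt_le_trans _ _ (\sum_(x in B) dl * #|Y'|%:R)).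
  apply: ltr_sum => [|x]; last by rewrite inE => /andP[].
  have /set0Pn[x xB] : B != set0.
    by rewrite -card_gt0 -(ltr_nat R) (le_lt_trans _ lt) // mulr_ge0.
  by apply/hasP; exists x => //; rewrite mem_index_enum.
rewrite sumr_const -[leLHS]mulr_natr [leRHS]mulrA -mulrA -mulrA [_ * #|B|%:R]mulrC.
by rewrite ler_wpM2r // mulr_ge0.
Qed.

Lemma card_slice_ge (B : finType) (T : {set V * B}) (G : {set V}) (s : R) :
  (forall x, x \in G -> s <= #|slice T x|%:R) -> #|G|%:R * s <= #|T|%:R.
Proof.
move=> h; rewrite -sum_slice natr_sum mulr_natl -sumr_const.
rewrite [leRHS](bigID (mem G)) /= -[leLHS]addr0; apply: lerD; last exact: sumr_ge0.
exact: ler_sum.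
Qed.

Lemma card_diff_ge (X B : {set V}) (a b : R) : a <= #|X|%:R ->
  #|B|%:R <= b -> a - b <= #|X :\: B|%:R.
Proof.
move=> h1 h2; rewrite lerBlDr; apply: le_trans h1 _.
apply: (@le_trans _ _ (#|X :\: B|%:R + #|B|%:R)); last by rewrite lerD2l.
by rewrite -natrD ler_nat -(cardsID B X) addnC leq_add2l subset_leq_card // subsetIr.
Qed.

Lemma count_K4 (eps dl : R) (X Y Z W : {set V}) : 0 <= eps -> 0 <= dl <= 1 / 2 ->
  eps <= dl ^+ 2 / 2 ->
  all (fun p => lower_regular f eps p.1 p.2 && (dl <= dens f p.1 p.2 - eps))
    [:: (X, Y); (X, Z); (X, W); (Y, Z); (Y, W); (Z, W)] ->
  dl ^+ 6 / 8 * (#|X|%:R * (#|Y|%:R * (#|Z|%:R * #|W|%:R)))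
  <= #|[set q : V * (V * (V * V)) |
    [&& e q.1 q.2.1, e q.1 q.2.2.1, e q.1 q.2.2.2, e q.2.1 q.2.2.1, e q.2.1 q.2.2.2
      & e q.2.2.1 q.2.2.2]]|%:R.
Proof.
move=> e0 /andP[d0 d1] ed /= /and5P[].
move=> /andP[rXY dXY] /andP[rXZ dXZ] /andP[rXW dXW] /andP[rYZ dYZ].
move=> /andP[/andP[rYW dYW] /andP[/andP[rZW dZW] _]].
set T := [set q | _].
have dd : dl ^+ 2 <= dl / 2 by rewrite expr2; nra.
have e1 : eps <= 1 by nra.
have ed1 : eps <= dl by nra.
have ed2 : eps <= dl ^+ 2 by nra.
pose bad (A B : {set V}) := [set x in A | #|nbrs x B|%:R < dl * #|B|%:R].
have good (A B : {set V}) x : x \in A -> x \notin bad A B ->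
    dl * #|B|%:R <= #|nbrs x B|%:R.
  by move=> xA; rewrite inE xA /= -leNgt.
have sub_n x (A : {set V}) : nbrs x A \subset A by apply/subsetP => y; rewrite inE => /andP[].
have small (k : R) (A B : {set V}) : k <= 1 -> k * #|A|%:R <= #|A|%:R :> R.
  by move=> k1; rewrite ler_piMl.
pose G := X :\: (bad X Y :|: bad X Z :|: bad X W).
have cU (A B : {set V}) (a b : R) : #|A|%:R <= a -> #|B|%:R <= b -> #|A :|: B|%:R <= a + b.
  move=> h1 h2; apply: le_trans (lerD h1 h2); rewrite -natrD ler_nat; exact: leq_card_setU.
have cG : 1 / 2 * #|X|%:R <= #|G|%:R :> R.
  apply: (@le_trans _ _ (#|X|%:R - (eps * #|X|%:R + eps * #|X|%:R + eps * #|X|%:R))).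
    have : 0 <= #|X|%:R :> R by []. nra.
  apply: card_diff_ge => //; apply: (cU); first apply: (cU).
  - exact: few_atypical rXY dXY _ (small _ _ Y e1).
  - exact: few_atypical rXZ dXZ _ (small _ _ Z e1).
  - exact: few_atypical rXW dXW _ (small _ _ W e1).
apply: (@le_trans _ _ (#|G|%:R * (dl ^+ 5 / 4 * dl * (#|Y|%:R * (#|Z|%:R * #|W|%:R))))).
  have -> : dl ^+ 6 / 8 * (#|X|%:R * (#|Y|%:R * (#|Z|%:R * #|W|%:R)))
     = (1 / 2 * #|X|%:R) * (dl ^+ 5 / 4 * dl * (#|Y|%:R * (#|Z|%:R * #|W|%:R))) by field.
  by rewrite ler_wpM2r // ?mulr_ge0 ?invr_ge0 ?exprn_ge0.
apply: card_slice_ge => x; rewrite in_setD !in_setU !negb_or.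
move=> /andP[/andP[/andP[xY xZ] xW] xX].
have {xY} nY := good X Y x xX xY; have {xZ} nZ := good X Z x xX xZ.
have {xW} nW := good X W x xX xW.
have le2 (A : {set V}) (k l : R) : k <= l -> k * #|A|%:R <= l * #|A|%:R.
  by move=> kl; rewrite ler_wpM2r.
pose G2 := nbrs x Y :\: (bad Y (nbrs x Z) :|: bad Y (nbrs x W)).
have cG2 : dl / 2 * #|Y|%:R <= #|G2|%:R.
  apply: (@le_trans _ _ (dl * #|Y|%:R - (eps * #|Y|%:R + eps * #|Y|%:R))).
    have : 0 <= #|Y|%:R :> R by []. nra.
  apply: card_diff_ge => //; apply: (cU).
  - apply: few_atypical rYZ dYZ (sub_n _ _) _ => //; apply: le_trans nZ; exact: le2.
  - apply: few_atypical rYW dYW (sub_n _ _) _ => //; apply: le_trans nW; exact: le2.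
apply: (@le_trans _ _ (#|G2|%:R * (dl ^+ 5 / 2 * (#|Z|%:R * #|W|%:R)))).
  have -> : dl ^+ 5 / 4 * dl * (#|Y|%:R * (#|Z|%:R * #|W|%:R))
     = (dl / 2 * #|Y|%:R) * (dl ^+ 5 / 2 * (#|Z|%:R * #|W|%:R)) by field.
  by rewrite ler_wpM2r // ?mulr_ge0 ?invr_ge0 ?exprn_ge0.
apply: card_slice_ge => y; rewrite inE => /andP[]; rewrite in_setU negb_or => /andP[by1 by2].
rewrite inE => /andP[yY xy].
have {by1} nZ2 := good _ _ _ yY by1; have {by2} nW2 := good _ _ _ yY by2.
have nZ3 : dl ^+ 2 * #|Z|%:R <= #|nbrs y (nbrs x Z)|%:R.
  by apply: le_trans nZ2; rewrite expr2 -mulrA ler_wpM2l.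
have nW3 : dl ^+ 2 * #|W|%:R <= #|nbrs y (nbrs x W)|%:R.
  by apply: le_trans nW2; rewrite expr2 -mulrA ler_wpM2l.
pose G3 := nbrs y (nbrs x Z) :\: bad Z (nbrs y (nbrs x W)).
have cG3 : dl ^+ 2 / 2 * #|Z|%:R <= #|G3|%:R.
  apply: (@le_trans _ _ (dl ^+ 2 * #|Z|%:R - eps * #|Z|%:R)).
    have : 0 <= #|Z|%:R :> R by []. nra.
  apply: card_diff_ge => //.
  apply: few_atypical rZW dZW (subset_trans (sub_n _ _) (sub_n _ _)) _ => //.
  apply: le_trans nW3; exact: le2.
apply: (@le_trans _ _ (#|G3|%:R * (dl ^+ 3 * #|W|%:R))).
  have -> : dl ^+ 5 / 2 * (#|Z|%:R * #|W|%:R)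
     = (dl ^+ 2 / 2 * #|Z|%:R) * (dl ^+ 3 * #|W|%:R) by field.
  by rewrite ler_wpM2r // ?mulr_ge0 ?exprn_ge0.
apply: card_slice_ge => z; rewrite inE => /andP[bz]; rewrite !inE => /andP[/andP[zZ xz] yz].
have {bz} nW4 := good _ _ _ zZ bz.
apply: (@le_trans _ _ #|nbrs z (nbrs y (nbrs x W))|%:R).
  by apply: le_trans nW4; rewrite exprS -mulrA ler_wpM2l.
rewrite ler_nat; apply: subset_leq_card; apply/subsetP => u; rewrite !inE /= xy xz yz.
by move=> /andP[/andP[/andP[_ ->] ->] ->].
Qed.

Definition cnbrs (Q Y : {set V}) : {set V} := [set y in Y | [forall q in Q, e q y]].

Lemma card_cnbrs (k : nat) (a : R) (Q Y : {set V}) : #|Q| = k ->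
  (forall q, q \in Q -> (1 - a) * #|Y|%:R <= #|nbrs q Y|%:R) ->
  (1 - k%:R * a) * #|Y|%:R <= #|cnbrs Q Y|%:R.
Proof.
move=> cQ h; have sub : Y :\: cnbrs Q Y \subset \bigcup_(q in Q) (Y :\: nbrs q Y).
  apply/subsetP => y; rewrite !inE => /andP[+ yY]; rewrite yY /= => /forall_inPn[q qQ qy].
  by apply/bigcupP; exists q => //; rewrite !inE yY (negbTE qy).
have h1 : #|Y :\: cnbrs Q Y|%:R <= k%:R * a * #|Y|%:R.
  apply: (@le_trans _ _ (\sum_(q in Q) #|Y :\: nbrs q Y|%:R)).
    rewrite -natr_sum ler_nat; apply: leq_trans (subset_leq_card sub) _.
    elim/big_rec2: _ => [|q m A qQ IH]; rewrite ?cards0 //.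
    by apply: leq_trans (leq_card_setU _ _) _; rewrite leq_add2l.
  apply: (@le_trans _ _ (\sum_(q in Q) a * #|Y|%:R)); last first.
    by rewrite sumr_const cQ -[leLHS]mulr_natl mulrA.
  apply: ler_sum => q /h; rewrite cardsD (setIidPr _); last first.
    by apply/subsetP => y; rewrite inE => /andP[].
  rewrite natrB ?subset_leq_card //; first lra.
  by apply/subsetP => y; rewrite inE => /andP[].
have : #|Y|%:R = #|cnbrs Q Y|%:R + #|Y :\: cnbrs Q Y|%:R :> R.
  rewrite -natrD -(cardsID (cnbrs Q Y) Y) (setIidPr _) //.
  by apply/subsetP => y; rewrite inE => /andP[].
lra.
Qed.

Hypothesis e_sym : symmetric e.
Hypothesis e_irr : irreflexive e.

Lemma full_triangle (eps eta tau : R) (X Y Z : {set V}) :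
  0 <= eps -> eps <= eta -> eta <= 1 / 4 -> 
  (forall S : {set V}, tau <= #|S|%:R -> has_clique e 4 S) ->
  tau <= eta ^+ 2 * #|X|%:R -> tau <= eta ^+ 2 * #|Y|%:R -> tau <= eta ^+ 2 * #|Z|%:R ->
  all (fun p => lower_regular f eps p.1 p.2 && (3 / 4 + eta <= dens f p.1 p.2 - eps))
    [:: (X, Y); (X, Z); (Y, Z)] ->
  has_clique e 12 [set: V].
Proof.
move=> e0 ee eta1 K4 tX tY tZ /= /and4P[/andP[rXY dXY] /andP[rXZ dXZ] /andP[rYZ dYZ] _].
pose dl := 3 / 4 + eta.
pose bad (A B : {set V}) := [set x in A | #|nbrs x B|%:R < dl * #|B|%:R].
have good (A B : {set V}) x : x \in A -> x \notin bad A B ->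
    dl * #|B|%:R <= #|nbrs x B|%:R.
  by move=> xA; rewrite inE xA /= -leNgt.
have small (A : {set V}) : eps * #|A|%:R <= #|A|%:R :> R by rewrite ler_piMl //; lra.
have cU (A B : {set V}) (a b : R) : #|A|%:R <= a -> #|B|%:R <= b -> #|A :|: B|%:R <= a + b.
  move=> h1 h2; apply: le_trans (lerD h1 h2); rewrite -natrD ler_nat; exact: leq_card_setU.
have sub_c (Q A : {set V}) : cnbrs Q A \subset A by apply/subsetP => y; rewrite inE => /andP[].
have ee2 : eta ^+ 2 <= eta by rewrite expr2; nra.
have [X0 Y0 Z0] : [/\ 0 <= #|X|%:R :> R, 0 <= #|Y|%:R :> R & 0 <= #|Z|%:R :> R] by [].
have cn (Q A : {set V}) : #|Q| = 4%N ->
    (forall q, q \in Q -> dl * #|A|%:R <= #|nbrs q A|%:R) ->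
    4 * eta * #|A|%:R <= #|cnbrs Q A|%:R.
  move=> cQ h; have := @card_cnbrs 4 (1 - dl) Q A cQ _.
  rewrite subKr => /(_ h); apply: le_trans; rewrite /dl; have : 0 <= #|A|%:R :> R by []. nra.
have [|Q1 [s1 c1 k1]] := has_cliqueP _ _ _ (K4 (X :\: (bad X Y :|: bad X Z)) _).
  apply: (@le_trans _ _ (#|X|%:R - (eps * #|X|%:R + eps * #|X|%:R))); first by nra.
  apply: card_diff_ge => //; apply: (cU).
  - exact: few_atypical rXY dXY _ (small Y).
  - exact: few_atypical rXZ dXZ _ (small Z).
have g1 q : q \in Q1 -> dl * #|Y|%:R <= #|nbrs q Y|%:R /\ dl * #|Z|%:R <= #|nbrs q Z|%:R.
  move=> /(subsetP s1); rewrite in_setD in_setU negb_or => /andP[/andP[b1 b2] qX].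
  by split; [apply: (good X Y)|apply: (good X Z)].
have nY := cn Q1 Y c1 (fun q h => (g1 q h).1).
have nZ := cn Q1 Z c1 (fun q h => (g1 q h).2).
have [|Q2 [s2 c2 k2]] := has_cliqueP _ _ _ (K4 (cnbrs Q1 Y :\: bad Y (cnbrs Q1 Z)) _).
  apply: (@le_trans _ _ (4 * eta * #|Y|%:R - eps * #|Y|%:R)); first by nra.
  apply: card_diff_ge => //.
  apply: few_atypical rYZ dYZ (sub_c _ _) _ => //; apply: le_trans nZ.
  by rewrite ler_wpM2r //; lra.
have g2 q : q \in Q2 -> dl * #|cnbrs Q1 Z|%:R <= #|nbrs q (cnbrs Q1 Z)|%:R.
  move=> /(subsetP s2); rewrite in_setD => /andP[b qY].
  by apply: (good Y) b; apply: (subsetP (sub_c _ _)) qY.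
have nZ2 := cn Q2 _ c2 g2.
have [|Q3 [s3 c3 k3]] := has_cliqueP _ _ _ (K4 (cnbrs Q2 (cnbrs Q1 Z)) _).
  apply: le_trans nZ2; apply: (@le_trans _ _ (4 * eta * (4 * eta * #|Z|%:R))); last first.
    by rewrite ler_wpM2l //; lra.
  have : 0 <= eta ^+ 2 * #|Z|%:R by rewrite mulr_ge0 ?sqr_ge0.
  rewrite expr2 in tZ *; nra.
have j12 : joined e Q1 Q2.
  apply/joinedP => x y xQ /(subsetP s2); rewrite !inE => /andP[_ /andP[_]].
  by move=> /forall_inP; apply.
have j13 : joined e Q1 Q3.
  apply/joinedP => x y xQ /(subsetP s3); rewrite !inE => /andP[/andP[_]].
  by move=> /forall_inP h _; apply: h.
have j23 : joined e Q2 Q3.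
  apply/joinedP => x y xQ /(subsetP s3); rewrite !inE => /andP[_].
  by move=> /forall_inP; apply.
have [l12 n12] := clique_join e_sym e_irr k1 k2 j12.
have [l n] := clique_join e_sym e_irr l12 k3 (joinedU j13 j23).
apply/has_cliqueP; exists (Q1 :|: Q2 :|: Q3); split=> //.
by rewrite n n12 c1 c2 c3.
Qed.

End Embedding.

Lemma sum_card_cls (R : realFieldType) (V C : finType) (c : V -> C) :
  \sum_a #|cls c a|%:R = #|V|%:R :> R.
Proof.
rewrite -natr_sum; congr (_%:R); rewrite -sum1_card (partition_big c xpredT) //=.
by apply: eq_bigr => a _; rewrite -sum1_card; apply: eq_bigl => v; rewrite inE.
Qed.

Lemma lower_regular_sym (R : realFieldType) (V : finType) (f : V -> V -> R)
    (eps : R) (X Y : {set V}) : (forall x y, f x y = f y x) ->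
  lower_regular f eps X Y = lower_regular f eps Y X /\ dens f X Y = dens f Y X.
Proof.
move=> fs; have es (A B : {set V}) : edge_sum f A B = edge_sum f B A.
  by rewrite /edge_sum exchange_big; apply: eq_bigr => x _; apply: eq_bigr.
have ds : dens f X Y = dens f Y X by rewrite /dens es mulrC [_ * #|Y|%:R]mulrC mulrC.
split=> //; apply/idP/idP => h; apply/forallP => A; apply/forallP => B;
  apply/implyP => /and4P[h1 h2 h3 h4];
  move/forallP/(_ B)/forallP/(_ A)/implyP: h; rewrite h1 h2 h3 h4 => /(_ isT).
- by rewrite ds (es A) [#|B|%:R * _]mulrC.
- by rewrite ds (es A) [#|B|%:R * _]mulrC.
Qed.

Lemma edge_bound (R : archiRealFieldType) (M : nat) (gamma : R) :
  M = (120 * (120 * 120))%N -> 0 < gamma ->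
  exists tau w0 : R, 0 < tau /\ forall (V : finType) (e : rel V) (w : R),
    symmetric e -> irreflexive e -> w0 <= w -> 1 <= w -> #|V|%:R = w ^+ (40 * M) ->
    (forall S : {set V}, tau * #|V|%:R <= #|S|%:R -> has_clique e 4 S) ->
    (forall S : {set V}, w ^+ (39 * M) - 1 <= #|S|%:R -> has_clique e 3 S) ->
    ~~ has_clique e 12 [set: V] ->
    \sum_x \sum_y (e x y)%:R <= (8 / 13 + gamma) * #|V|%:R ^+ 2.
Proof.
move=> hM g0; pose eta : R := Num.min (gamma / 2) (1 / 4).
have eta0 : 0 < eta by rewrite lt_min !divr_gt0.
have eta1 : eta <= 1 / 4 by rewrite ge_min lexx orbT.
have etag : eta <= gamma / 2 by rewrite ge_min lexx.
pose eps := eta ^+ 2 / 4; have eps0 : 0 < eps by rewrite divr_gt0 // exprn_gt0.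
have epsE : eps <= eta / 4 by rewrite /eps expr2; nra.
have [K HK] := regularity eps0.
pose s : R := eps / K.+1%:R; have s0 : 0 < s by rewrite divr_gt0.
exists (eta ^+ 2 * s), (8 / (eta ^+ 6 * s ^+ 4)); split.
  by rewrite mulr_gt0 ?exprn_gt0.
move=> V e w es ei ww w1 hn K4 K3 no12.
pose f x y : R := (e x y)%:R.
have f01 x y : 0 <= f x y <= 1 by rewrite /f; case: (e x y); rewrite ?ler01 ?lexx.
have fs x y : f x y = f y x by rewrite /f es.
have [C [c [cC irr]]] := HK V f f01.
pose m a : R := #|cls c a|%:R.
have m0 a : 0 <= m a by [].
have n0 : 0 <= #|V|%:R :> R by [].
pose D a b := dens f (cls c a) (cls c b).
pose reg a b := lower_regular f eps (cls c a) (cls c b).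
pose big a := s * #|V|%:R <= m a.
pose r a b := [&& reg a b, big a, big b & eta + eps <= D a b].
pose fu a b := r a b && (3 / 4 + eta + eps <= D a b).
have Ds a b : D a b = D b a by have [] := lower_regular_sym eps (cls c a) (cls c b) fs.
have regs a b : reg a b = reg b a.
  by have [] := lower_regular_sym eps (cls c a) (cls c b) fs.
have rs : symmetric r by move=> a b; rewrite /r regs Ds; congr (_ && _); rewrite andbCA.
have fus : symmetric fu by move=> a b; rewrite /fu rs Ds.
have noK4 a b d k : ~~ [&& r a b, r a d, r a k, r b d, r b k & r d k].
  apply: contra no12 => /and5P[rab rad rak rbd /andP[rbk rdk]].
  apply: (clique12_of_many_K4 es ei hM w1 hn _ K3).
  have eta12 : 0 <= eta <= 1 / 2 by apply/andP; split; [exact: ltW | lra].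
  have eps2 : eps <= eta ^+ 2 / 2 by rewrite /eps; have := sqr_ge0 eta; lra.
  have hT := @count_K4 R V e eps eta (cls c a) (cls c b) (cls c d) (cls c k)
    (ltW eps0) eta12 eps2.
  have /hT {}hT : all (fun p => lower_regular f eps p.1 p.2 && (eta <= dens f p.1 p.2 - eps))
    [:: (cls c a, cls c b); (cls c a, cls c d); (cls c a, cls c k);
        (cls c b, cls c d); (cls c b, cls c k); (cls c d, cls c k)].
    rewrite /= andbT; apply/and5P; split; last (apply/andP; split);
    [case/and4P: rab|case/and4P: rad|case/and4P: rak|case/and4P: rbd|case/and4P: rbk
      |case/and4P: rdk]; move=> h1 _ _ h2; apply/andP; split=> //; rewrite lerBrDr; exact: h2.
  move: hT; set T := (X in _ <= X); move=> hT.
  have big4 : eta ^+ 6 / 8 * (s * #|V|%:R) ^+ 4 <= T.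
    apply: le_trans hT; rewrite ler_wpM2l ?divr_ge0 ?exprn_ge0 ?(ltW eta0) //.
    have [ba bb] : big a /\ big b by case/and4P: rab.
    have [bd bk] : big d /\ big k by case/and4P: rdk.
    have sn : 0 <= s * #|V|%:R by rewrite mulr_ge0 // ltW.
    rewrite !exprS expr0 mulr1.
    apply: ler_pM _ _ ba _ => //; first by apply: mulr_ge0 => //; apply: mulr_ge0.
    apply: ler_pM _ _ bb _ => //; first exact: mulr_ge0.
    by apply: ler_pM _ _ bd bk.
  have p0 : 0 < eta ^+ 6 * s ^+ 4 by rewrite mulr_gt0 ?exprn_gt0.
  apply: (@le_trans _ _ (w * (eta ^+ 6 / 8 * (s * #|V|%:R) ^+ 4))); last first.
    by rewrite ler_wpM2l // (le_trans _ w1).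
  rewrite (_ : w * _ = (w * (eta ^+ 6 * s ^+ 4) / 8) * #|V|%:R ^+ 4); last first.
    by rewrite exprMn; field.
  rewrite ler_peMl ?exprn_ge0 // ler_pdivlMr // mul1r.
  by rewrite -ler_pdivrMr.
have noK3 a b d : ~~ [&& fu a b, fu a d & fu b d].
  apply: contra no12 => /and3P[/andP[/and4P[r1 ba bb _] d1] /andP[/and4P[r2 _ bd _] d2]].
  move=> /andP[/and4P[r3 _ _ _] d3].
  have tb x : big x -> eta ^+ 2 * s * #|V|%:R <= eta ^+ 2 * #|cls c x|%:R.
    by move=> bx; rewrite -mulrA ler_wpM2l ?sqr_ge0.
  apply: (full_triangle es ei (ltW eps0) _ eta1 K4 (tb _ ba) (tb _ bb) (tb _ bd)).
    by lra.
  rewrite /= andbT; apply/and3P; split; apply/andP; split=> //; rewrite lerBrDr;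
    [exact: d1|exact: d2|exact: d3].
have lag := lagrangian rs fus noK4 noK3 m0.
rewrite sum_card_cls in lag.
pose S a b : R := (~~ big a)%:R * (m a * m b).
have sumS : \sum_a \sum_b S a b <= eps * #|V|%:R ^+ 2.
  apply: (@le_trans _ _ (\sum_(a : C) s * #|V|%:R * #|V|%:R)).
    apply: ler_sum => a _; rewrite /S.
    rewrite -mulr_sumr -mulr_sumr sum_card_cls.
    have [ba|ba] := boolP (big a); first by rewrite mul0r; apply: mulr_ge0 => //; apply: mulr_ge0 => //; apply: ltW.
    by rewrite mul1r ler_wpM2r // ltW // ltNge.
  rewrite sum_constT.
  have -> : s * #|V|%:R * #|V|%:R * #|C|%:R = s * #|C|%:R * #|V|%:R ^+ 2 by ring.
  rewrite ler_wpM2r ?sqr_ge0 // /s mulrAC ler_pdivrMr // ler_wpM2l ?ler_nat ?(ltW eps0) //.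
  exact: leqW.
have sumS' : \sum_a \sum_b S b a <= eps * #|V|%:R ^+ 2 by rewrite exchange_big.
have summ : \sum_a \sum_b (eta + eps) * (m a * m b) = (eta + eps) * #|V|%:R ^+ 2.
  under eq_bigr => a _ do rewrite -mulr_sumr -mulr_sumr sum_card_cls.
  by rewrite -mulr_sumr -mulr_suml sum_card_cls expr2.
have irr' : \sum_a \sum_b (~~ reg a b)%:R * (m a * m b) <= eps * #|V|%:R ^+ 2.
  apply: le_trans irr; apply: ler_sum => a _; rewrite [leRHS]big_mkcond /=.
  apply: ler_sum => b _; rewrite -/(reg a b) /m; case: (reg a b) => /=.
    by rewrite mul0r.
  by rewrite mul1r.
rewrite (sum_cls c f).
apply: (@le_trans _ _ (\sum_a \sum_b ((r a b)%:R * (3 / 4 + (fu a b)%:R / 4) * m a * m b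
   + (eta + eps) * (m a * m b) + (~~ reg a b)%:R * (m a * m b) + S a b + S b a))).
  apply: ler_sum => a _; apply: ler_sum => b _.
  rewrite -/(edge_sum f (cls c a) (cls c b)) -(densK f01) -/(D a b) -/(m a) -/(m b).
  have mm : 0 <= m a * m b by rewrite mulr_ge0.
  have D1 : D a b <= 1 by exact: dens_le1.
  rewrite /S [m b * m a]mulrC -[_ * m a * m b]mulrA -!mulrDl ler_wpM2r //.
  rewrite /fu /r; case: (reg a b) => /=; last by case: (big a); case: (big b) => /=; lra.
  case: (big a) => /=; last by case: (big b) => /=; lra.
  case: (big b) => /=; last by lra.
  have [h1|h1] := lerP (eta + eps) (D a b); rewrite /=; last by lra.
  by have [h2|h2] := lerP (3 / 4 + eta + eps) (D a b); rewrite /=; lra.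
under eq_bigr => a _ do rewrite !big_split /=.
rewrite !big_split /= summ.
have n2 : 0 <= #|V|%:R ^+ 2 :> R by rewrite sqr_ge0.
have fin : (eta + 4 * eps) * #|V|%:R ^+ 2 <= gamma * #|V|%:R ^+ 2.
  by rewrite ler_wpM2r //; lra.
lra.
Qed.

(** * K_4-free graphs with small independence number *)

Section RandomGraph.
Variables (R : realFieldType) (V : finType).
Implicit Types (Q S A : {set V}) (W P N : {set {set V}}).

Definition pairs S : {set {set V}} := [set A : {set V} | A \subset S & #|A| == 2%N].

Lemma card_pairs S : #|pairs S| = 'C(#|S|, 2).
Proof. exact: cards_draws. Qed.

Lemma sum_subsets (T : finType) (K : {set T}) (x : R) :
  \sum_(J : {set T} | J \subset K) x ^+ #|J| = (1 + x) ^+ #|K|.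
Proof.
have -> : (1 + x) ^+ #|K| = \prod_(i : T) ((if i \in K then x else 0) + 1).
  rewrite [RHS](bigID (mem K)) /= [X in _ * X]big1 ?mulr1; last first.
    by move=> i /negbTE ->; rewrite add0r.
  by rewrite (eq_bigr (fun=> 1 + x)) ?prodr_const // => i ->; rewrite addrC.
rewrite bigA_distr big_mkcond /=; apply: eq_bigr => J _.
case: ifPn => [JK|/subsetPn[i iJ iK]]; last by rewrite (bigD1 i) //= iJ (negbTE iK) mul0r.
rewrite (bigID (mem J)) /= [X in _ = _ * X]big1 ?mulr1; last by move=> i /negbTE ->.
rewrite (eq_bigr (fun=> x)) ?prodr_const // => i iJ.
by rewrite iJ (subsetP JK).
Qed.

Variable p : R.
Hypothesis p01 : 0 < p < 1.

Let p0 : 0 <= p. Proof. by case/andP: p01 => /ltW. Qed.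
Let q0 : 0 < 1 - p. Proof. by case/andP: p01 => _; rewrite subr_gt0. Qed.

Let wt (b : bool) : R := if b then p else 1 - p.
Let prob (f : {ffun {set V} -> bool}) : R := \prod_A wt (f A).

Let prob_ge0 f : 0 <= prob f.
Proof. by apply: prodr_ge0 => A _; rewrite /wt; case: (f A) => //; apply: ltW. Qed.

Definition present (P N : {set {set V}}) (f : {ffun {set V} -> bool}) : bool :=
  [forall A, ((A \in P) ==> f A) && ((A \in N) ==> ~~ f A)].

Lemma prob_present P N : [disjoint P & N] ->
  \sum_(f | present P N f) prob f = p ^+ #|P| * (1 - p) ^+ #|N|.
Proof.
move=> dPN; pose ok A (b : bool) := ((A \in P) ==> b) && ((A \in N) ==> ~~ b).
transitivity (\prod_A \sum_b wt b * (ok A b)%:R).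
  rewrite bigA_distr_bigA big_mkcond /=; apply: eq_bigr => f _.
  rewrite big_split /= -/(prob f).
  case: ifPn => [/forallP h|/forallPn[A nA]].
    by rewrite [X in _ * X]big1 ?mulr1 // => A _; rewrite /ok h.
  by rewrite [X in _ * X](bigD1 A) //= /ok (negbTE nA) mul0r mulr0.
have -> : p ^+ #|P| * (1 - p) ^+ #|N|
   = \prod_A ((if A \in P then p else 1) * (if A \in N then 1 - p else 1)).
  by rewrite big_split /= -!big_mkcond /= !prodr_const.
apply: eq_bigr => A _; rewrite big_bool /= /ok /wt.
case: (boolP (A \in P)) => [AP|_] /=.
  by rewrite (disjointFr dPN AP) /= !mulr1 mulr0 addr0.
by case: (A \in N) => /=; rewrite ?mulr0 ?mulr1 ?add0r ?mul1r // addrC subrK.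
Qed.

Lemma sum_prob : \sum_f prob f = 1.
Proof.
rewrite -(bigA_distr_bigA (fun _ b => wt b)) big1 // => A _.
by rewrite big_bool /wt /= addrC subrK.
Qed.

Definition edge_disjoint W : bool :=
  [forall Q in W, forall Q' in W, (Q != Q') ==> [disjoint pairs Q & pairs Q']].

Definition meeting S : {set {set V}} :=
  [set Q : {set V} | (#|Q| == 4%N) && ~~ [disjoint pairs Q & pairs S]].

Definition hull W : {set {set V}} := \bigcup_(Q in W) pairs Q.

Lemma card_hull W : edge_disjoint W -> (forall Q, Q \in W -> #|Q| = 4%N) ->
  #|hull W| = (6 * #|W|)%N.
Proof.
move=> dW cW; rewrite /hull.
have inj : {in W &, injective pairs}.
  move=> Q Q' QW QW' eq; apply/eqP/negPn/negP => ne.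
  move/forall_inP/(_ Q QW)/forall_inP/(_ Q' QW')/implyP/(_ ne): dW.
  rewrite eq -setI_eq0 setIid => /eqP/(congr1 (fun X : {set {set V}} => #|X|)).
  by rewrite card_pairs cards0 cW.
have tI : trivIset [set pairs Q | Q in W].
  apply/trivIsetP => _ _ /imsetP[Q QW ->] /imsetP[Q' QW' ->] ne.
  move/forall_inP/(_ Q QW)/forall_inP/(_ Q' QW')/implyP: dW; apply.
  by apply: contraNneq ne => ->.
have -> : \bigcup_(Q in W) pairs Q = cover [set pairs Q | Q in W] by rewrite cover_imset.
rewrite -(eqP tI) big_imset //=.
rewrite (eq_bigr (fun=> 6%N)) ?sum_nat_const 1?mulnC // => Q QW.
by rewrite card_pairs cW.
Qed.

Lemma card_meeting S : (#|meeting S| <= #|V| ^ 2 * 'C(#|S|, 2))%N.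
Proof.
pose g (q : {set V} * (V * V)) := q.1 :|: [set q.2.1; q.2.2].
apply: (@leq_trans #|[set g q | q in setX (pairs S) [set: V * V]]|).
  apply: subset_leq_card; apply/subsetP => Q; rewrite inE => /andP[/eqP cQ].
  rewrite -setI_eq0 => /set0Pn[A]; rewrite in_setI => /andP[AQ AS].
  move: AQ; rewrite inE => /andP[AQ /eqP cA].
  have : #|Q :\: A| == 2%N by rewrite cardsD (setIidPr AQ) cQ cA.
  case/cards2P => x [y [_ E]]; apply/imsetP; exists (A, (x, y)).
    by rewrite !inE /=; move: AS; rewrite inE => ->.
  rewrite /g /= -E; apply/setP => z; rewrite !inE.
  by case: (boolP (z \in A)) => //= zA; rewrite (subsetP AQ).
apply: leq_trans (leq_imset_card _ _) _.
by rewrite cardsX card_pairs cardsT card_prod mulnC.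
Qed.

(* Given a random graph [f], keep the edges lying in no member of a maximal family of
   edge-disjoint copies of K_4.  If S is then independent, the edges of [f] inside S
   are covered by the members of the family meeting S. *)
Let failure S W (f : {ffun {set V} -> bool}) : bool :=
  [&& W \subset meeting S, edge_disjoint W & present (hull W) (pairs S :\: hull W) f].

Lemma prob_failure S W : \sum_(f | failure S W f) prob f <=
  if W \subset meeting S
  then ((p / (1 - p)) ^+ 6) ^+ #|W| * (1 - p) ^+ 'C(#|S|, 2) else 0.
Proof.
have r0 : 0 <= p / (1 - p) by rewrite divr_ge0 // ltW.
rewrite /failure; case: ifPn => sW /=; last by rewrite big_pred0.
case: (boolP (edge_disjoint W)) => dW /=; last first.
  by rewrite big_pred0 // mulr_ge0 ?exprn_ge0 // ltW.
rewrite prob_present; last first.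
  rewrite -setI_eq0; apply/eqP/setP => A; rewrite in_setI in_setD in_set0.
  by case: (A \in hull W).
rewrite -!exprM (card_hull dW) => [|Q /(subsetP sW)]; last by rewrite inE => /andP[/eqP].
rewrite expr_div_n -mulrA ler_wpM2l ?exprn_ge0 // mulrC ler_pdivlMr ?exprn_gt0 //.
rewrite -exprD; apply: ler_wiXn2l; rewrite ?(ltW q0) ?gerBl //.
rewrite -card_pairs -(card_hull dW) => [|Q /(subsetP sW)]; last by rewrite inE => /andP[/eqP].
by rewrite -(cardsID (hull W) (pairs S)) addnC leq_add2l subset_leq_card // subsetIr.
Qed.

Lemma exists_good_coloring (t : nat) :
  'C(#|V|, t)%:R * ((1 + (p / (1 - p)) ^+ 6) ^+ (#|V| ^ 2) * (1 - p)) ^+ 'C(t, 2) < 1 ->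
  exists f, forall S W, #|S| = t -> ~~ failure S W f.
Proof.
move=> lt1; set x := (p / (1 - p)) ^+ 6 in lt1.
have x0 : 0 <= x by rewrite exprn_ge0 // divr_ge0 // ltW.
have [/existsP[f hf]|] := boolP [exists f, [forall S : {set V}, (#|S| == t) ==>
    [forall W, ~~ failure S W f]]].
  exists f => S W cS; move/forallP/(_ S)/implyP: hf; rewrite cS eqxx => /(_ isT).
  by move/forallP.
rewrite negb_exists => /forallP bad; exfalso; move: lt1; apply/negP; rewrite -leNgt -[leLHS]sum_prob.
apply: (@le_trans _ _ (\sum_(S : {set V} | #|S| == t) \sum_W \sum_(f | failure S W f) prob f)).
  rewrite (eq_bigr (fun S => \sum_f \sum_W (if failure S W f then prob f else 0))); last first.
    by move=> S _; rewrite exchange_big; apply: eq_bigr => W _; rewrite -big_mkcond.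
  rewrite exchange_big /=; apply: ler_sum => f _.
  have /forallPn[S] := bad f; rewrite negb_imply => /andP[cS /forallPn[W]].
  rewrite negbK => fSW; rewrite (bigD1 S) //= (bigD1 W) //= fSW -addrA lerDl.
  apply: addr_ge0; first by apply: sumr_ge0 => W' _; case: ifP.
  by apply: sumr_ge0 => S' _; apply: sumr_ge0 => W' _; case: ifP.
apply: (@le_trans _ _ (\sum_(S : {set V} | #|S| == t)
    ((1 + x) ^+ (#|V| ^ 2) * (1 - p)) ^+ 'C(t, 2))); last first.
  rewrite sumr_const -[leLHS]mulr_natl ler_wpM2r //.
    apply: exprn_ge0; apply: mulr_ge0 (ltW q0).
    by rewrite exprn_ge0 // addr_ge0.
  rewrite ler_nat -card_draws; apply: subset_leq_card.
  by apply/subsetP => S; rewrite !inE.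
apply: ler_sum => S /eqP cS.
apply: le_trans (ler_sum _ (fun W _ => prob_failure S W)) _.
rewrite -big_mkcond /= -mulr_suml sum_subsets -/x cS exprMn -exprM.
rewrite ler_wpM2r ?exprn_ge0 ?(ltW q0) // ler_weXn2l //; first by rewrite lerDl.
by rewrite -cS card_meeting.
Qed.

Lemma random_K4_free (t : nat) : (0 < t)%N ->
  'C(#|V|, t)%:R * ((1 + (p / (1 - p)) ^+ 6) ^+ (#|V| ^ 2) * (1 - p)) ^+ 'C(t, 2) < 1 ->
  exists e : rel V, [/\ symmetric e, irreflexive e, ~~ has_clique e 4 [set: V] &
    forall I : {set V}, {in I &, forall x y, ~~ e x y} -> (#|I| < t)%N].
Proof.
move=> t0 /exists_good_coloring[f hf].
pose packing W := edge_disjoint W &&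
  [forall Q in W, (#|Q| == 4%N) && [forall A in pairs Q, f A]].
have pk0 : packing set0.
  by rewrite /packing /edge_disjoint; apply/andP; split; apply/forall_inP => Q; rewrite inE.
have [W /maxsetP[/andP[dW /forall_inP pW] maxW] _] := maxset_exists pk0.
pose e x y := [&& x != y, f [set x; y] & [forall Q in W, ~~ ([set x; y] \subset Q)]].
exists e; split.
- by move=> x y; rewrite /e eq_sym setUC.
- by move=> x; rewrite /e eqxx.
- apply/negP => /has_cliqueP[Q [_ cQ /cliqueP clQ]].
  have eQ A : A \in pairs Q -> f A && [forall Q' in W, ~~ (A \subset Q')].
    rewrite inE => /andP[AQ /cards2P[x [y [xy E]]]]; move: AQ; rewrite E.
    rewrite subUset !sub1set => /andP[xQ yQ].
    by case/and3P: (clQ x y xQ yQ xy) => _ -> ->.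
  have QW : Q \in W.
    rewrite -(maxW (Q |: W)) ?setU11 ?subsetU1 //; apply/andP; split; last first.
      apply/forall_inP => Q'; rewrite !inE => /predU1P[->|/pW //].
      by rewrite cQ eqxx; apply/forall_inP => A /eQ /andP[].
    have dj Q' : Q' \in W -> [disjoint pairs Q & pairs Q'].
      move=> Q'W; rewrite -setI_eq0; apply/eqP/setP => A; rewrite in_setI in_set0.
      apply/negP => /andP[/eQ /andP[_ /forall_inP/(_ _ Q'W)]].
      by move=> /negbTE nA; rewrite inE nA.
    apply/forall_inP => Q1; rewrite !inE => /predU1P[->|Q1W];
      apply/forall_inP => Q2; rewrite !inE => /predU1P[->|Q2W]; apply/implyP => ne.
    + by rewrite eqxx in ne.
    + exact: dj.
    + by rewrite disjoint_sym dj.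
    + by move/forall_inP/(_ _ Q1W)/forall_inP/(_ _ Q2W)/implyP: dW; apply.
  have : (0 < #|pairs Q|)%N by rewrite card_pairs cQ.
  case/card_gt0P => A AQ; have /andP[_ /forall_inP/(_ _ QW)] := eQ A AQ.
  by move: AQ; rewrite inE => /andP[->].
move=> I iI; rewrite ltnNge; apply/negP => tI.
have [S SI cS] : exists2 S : {set V}, S \subset I & #|S| = t.
  have : (0 < #|[set A : {set V} | A \subset I & #|A| == t]|)%N.
    by rewrite cards_draws bin_gt0.
  by case/card_gt0P => S; rewrite inE => /andP[? /eqP ?]; exists S.
pose W' := W :&: meeting S.
have /negP[] := hf S W' cS; apply/and3P; split; first exact: subsetIr.
- apply/forall_inP => Q1; rewrite in_setI => /andP[Q1W _].
  apply/forall_inP => Q2; rewrite in_setI => /andP[Q2W _].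
  by move/forall_inP/(_ _ Q1W)/forall_inP/(_ _ Q2W): dW.
apply/forallP => A; apply/andP; split; apply/implyP.
  case/bigcupP => Q; rewrite in_setI => /andP[QW _] AQ.
  by have /andP[_ /forall_inP] := pW Q QW; apply.
rewrite in_setD => /andP[nA AS]; apply/negP => fA.
move: (AS); rewrite inE => /andP[sA /cards2P[x [y [xy E]]]].
move: sA; rewrite E subUset !sub1set => /andP[xS yS].
have := iI x y (subsetP SI _ xS) (subsetP SI _ yS).
rewrite /e xy -E fA /= => /forall_inPn[Q QW]; rewrite negbK => AQ.
have cA : #|A| == 2%N by rewrite E cards2 xy.
have AQ' : A \in pairs Q by rewrite inE AQ.
case/negP: nA; apply/bigcupP; exists Q => //; rewrite in_setI QW inE /=.
have /andP[-> _] := pW Q QW; rewrite -setI_eq0; apply/set0Pn; exists A.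
by rewrite in_setI AQ'.
Qed.

End RandomGraph.

Lemma exp_dominates (y : nat) : (2 ^ 9 <= y)%N -> ((4 * y.+1) ^ 40 < 2 ^ y)%N.
Proof.
move=> hy; have y0 : (0 < y)%N by apply: leq_trans hy.
have [h1 h2] := andP (trunc_log_bounds (ltnSn 1) y0).
set s := trunc_log 2 y in h1 h2.
have s9 : (9 <= s)%N by apply: trunc_log_max.
have hk k : ((4 * y.+1) ^ k.+1 <= 2 ^ (k.+1 * s.+3))%N.
  rewrite [(k.+1 * _)%N]mulnC expnM leq_exp2r //.
  have -> : (2 ^ s.+3 = 4 * 2 ^ s.+1)%N by rewrite !expnS; lia.
  by rewrite leq_pmul2l.
apply: leq_ltn_trans (hk 39%N) _.
rewrite ltn_exp2l //; apply: leq_trans h1.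
elim: s s9 {h2 hk} => // s IH; rewrite leq_eqVlt => /predU1P[<- //|]; rewrite ltnS => /IH.
by rewrite expnS; lia.
Qed.

Section Bounds.
Variable R : realFieldType.

Lemma bernoulli_sub (a : R) (k : nat) : 0 <= a <= 1 -> 1 - k%:R * a <= (1 - a) ^+ k.
Proof.
move=> /andP[a0 a1]; elim: k => [|k IH]; first by rewrite expr0 mul0r subr0.
have a2 : 0 <= 1 - a by lra.
rewrite exprS -natr1; have := ler_wpM2l a2 IH; apply: le_trans.
have : 0 <= k%:R * a * a by rewrite !mulr_ge0.
lra.
Qed.

Lemma exp_one_plus_le (a : R) (k : nat) : 0 <= a -> k%:R * a < 1 ->
  (1 + a) ^+ k <= (1 - k%:R * a)^-1.
Proof.
move=> a0 ka; case: k ka => [|k] ka; first by rewrite expr0 mul0r subr0 invr1.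
have a1 : a <= 1.
  by apply: le_trans (ltW ka); rewrite ler_peMl // -natr1; rewrite lerDr.
have h := bernoulli_sub k.+1 (_ : 0 <= a <= 1); rewrite a0 a1 in h; have {}h := h isT.
have k0 : 0 < 1 - k.+1%:R * a by rewrite subr_gt0.
rewrite -[leRHS]mul1r ler_pdivlMr //.
apply: (@le_trans _ _ ((1 + a) ^+ k.+1 * (1 - a) ^+ k.+1)).
  by rewrite ler_wpM2l // exprn_ge0 // addr_ge0.
rewrite -exprMn exprn_ile1 //; have : 0 <= a * a by rewrite mulr_ge0.
  nra.
nra.
Qed.

Lemma exp_one_minus_le (m : nat) : (0 < m)%N -> (1 - m%:R^-1 : R) ^+ m <= 2^-1.
Proof.
case: m => // m _; set a : R := m.+1%:R^-1.
have a0 : 0 < a by rewrite invr_gt0.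
have a1 : a <= 1 by rewrite invf_le1 // ler1n.
have ma : m.+1%:R * a = 1 by rewrite /a mulfV ?pnatr_eq0.
have h : 2 <= (1 + a) ^+ m.+1.
  have h0 : 0 <= 1 + a by rewrite addr_ge0 // ltW.
  have := expr_tangent m ler01 h0; rewrite !expr1n mulr1 (_ : 1 + a - 1 = a); last by ring.
  by rewrite ma; lra.
rewrite -[leRHS]mul1r ler_pdivlMr //.
apply: (@le_trans _ _ ((1 - a) ^+ m.+1 * (1 + a) ^+ m.+1)).
  by rewrite ler_wpM2l // exprn_ge0 //; lra.
rewrite -exprMn exprn_ile1 //; have : 0 <= a * a by rewrite mulr_ge0 // ltW.
  nra.
nra.
Qed.

(* Edge probability [1 / (2 z ^ 8 + 1)] and independence number [z ^ 9]
   with [z = 4 (y + 1)] and [n <= z ^ 20]. *)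
Lemma K4_free_small_alpha (V : finType) (y : nat) : (2 ^ 9 <= y)%N ->
  (#|V| <= (4 * y.+1) ^ 20)%N ->
  exists e : rel V, [/\ symmetric e, irreflexive e, ~~ has_clique e 4 [set: V] &
    forall I : {set V}, {in I &, forall x y, ~~ e x y} ->
      (#|I| <= (4 * y.+1) ^ 9)%N].
Proof.
move=> hy; set z := (4 * y.+1)%N => hn.
have z0 : (0 < z)%N by [].
pose Z : R := z%:R ^+ 8; pose p : R := (2 * Z + 1)^-1.
have Z1 : 1 <= Z by rewrite exprn_ege1 // ler1n.
have p01 : 0 < p < 1 by rewrite /p invr_gt0 invf_lt1 ?andbT; lra.
have pE : p / (1 - p) = (2 * Z)^-1 by rewrite /p; field; lra.
have z9 : (0 < z ^ 9)%N by rewrite expn_gt0 z0.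
have [|e [es ei e4 eI]] := @random_K4_free R V p p01 _ z9 _; last first.
  by exists e; split=> // I /eI /ltnW.
rewrite pE; set x := (2 * Z)^-1 ^+ 6.
have x0 : 0 <= x by rewrite exprn_ge0 // invr_ge0; lra.
have xE : x * z%:R ^+ 40 = (64 * Z)^-1.
  have -> : z%:R ^+ 40 = Z ^+ 5 by rewrite /Z -exprM.
  by rewrite /x; field; lra.
have nx : (#|V| ^ 2)%:R * x <= (64 * Z)^-1.
  rewrite -xE mulrC ler_wpM2l // -natrX ler_nat (_ : 40 = 20 * 2)%N // expnM.
  by rewrite leq_exp2r.
have Zi : (64 * Z)^-1 <= 1 / 64 by rewrite div1r lef_pV2 ?posrE; lra.
set b : R := 1 - (4 * Z)^-1.
have b0 : 0 <= b by rewrite subr_ge0 invf_le1; lra.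
have base : (1 + x) ^+ (#|V| ^ 2) * (1 - p) <= b.
  have p1 : 0 <= 1 - p by case/andP: p01; lra.
  apply: le_trans (ler_wpM2r p1 (exp_one_plus_le x0 _)) _; first lra.
  apply: (@le_trans _ _ ((1 - (64 * Z)^-1)^-1 * (1 - p))).
    by rewrite ler_wpM2r // lef_pV2 ?posrE; lra.
  rewrite mulrC ler_pdivrMr; last by lra.
  rewrite /b /p -subr_ge0.
  have -> : (1 - (4 * Z)^-1) * (1 - (64 * Z)^-1) - (1 - (2 * Z + 1)^-1) =
    (120 * Z ^+ 2 - 66 * Z + 1) / (256 * Z ^+ 2 * (2 * Z + 1)) by field; lra.
  by rewrite divr_ge0 // ?mulr_ge0 ?sqr_ge0 //; nra.
have base0 : 0 <= (1 + x) ^+ (#|V| ^ 2) * (1 - p).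
  case/andP: p01 => _ p1; apply: mulr_ge0; last lra.
  by apply: exprn_ge0; apply: addr_ge0.
move: base base0; set B := (1 + x) ^+ _ * _; move: B => B base base0.
set t := (z ^ 9)%N in z9 *.
have tb : (#|V| ^ 2)%:R * b ^+ t.-1 < 1.
  have -> : t.-1 = (4 * z ^ 8 * y + (4 * z ^ 8).-1)%N.
    have : (0 < z ^ 8)%N by rewrite expn_gt0 z0.
    by rewrite /t expnS /z; nia.
  have b1 : b <= 1 by rewrite gerBl invr_ge0; lra.
  have bm : b ^+ (4 * z ^ 8) <= 2^-1.
    have -> : b = 1 - (4 * z ^ 8)%:R^-1 by rewrite /b /Z natrM natrX.
    by apply: exp_one_minus_le; rewrite muln_gt0 expn_gt0 z0.
  rewrite exprD exprM; apply: (@le_lt_trans _ _ ((z ^ 40)%:R * (2^-1 ^+ y * 1))).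
    apply: ler_pM => //; first by rewrite mulr_ge0 ?exprn_ge0.
      by rewrite ler_nat (_ : 40 = 20 * 2)%N // expnM leq_exp2r.
    apply: ler_pM; rewrite ?exprn_ge0 //; last by rewrite exprn_ile1.
    by rewrite lerXn2r // nnegrE ?exprn_ge0 // invr_ge0.
  by rewrite mulr1 exprVn ltr_pdivrMr ?exprn_gt0 // mul1r -natrX ltr_nat exp_dominates.
rewrite -(@ltr_pXn2r _ 2) ?nnegrE //; last by rewrite mulr_ge0 ?exprn_ge0.
apply: (@le_lt_trans _ _ (((#|V| ^ 2)%:R * b ^+ t.-1) ^+ t)); last first.
  by rewrite expr1n exprn_ilt1 ?mulr_ge0 ?exprn_ge0 // -lt0n.
rewrite !exprMn -!exprM; apply: ler_pM; rewrite ?exprn_ge0 //.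
  rewrite -!natrX ler_nat -expnM mulnC expnM leq_exp2r //.
  exact: leq_bin_exp.
rewrite (_ : ('C(t, 2) * 2)%N = (t.-1 * t)%N); last first.
  by rewrite bin2 muln2 halfK oddM; case: (t) z9 => //= k _; rewrite andNb subn0 mulnC.
by rewrite lerXn2r // nnegrE.
Qed.

End Bounds.

(** * Ramsey-Turan numbers *)

Section Graphs.
Variables (T : finType).
Implicit Types G : sgraph T.

Definition adj G : rel T := fun x y => [set x; y] \in edges G.

Lemma card_edge G (A : {set T}) : A \in edges G -> #|A| = 2%N.
Proof. by move=> AG; have /forall_inP/(_ A AG)/eqP := edges2 G. Qed.

Lemma adj_sym G : symmetric (adj G).
Proof. by move=> x y; rewrite /adj setUC. Qed.

Lemma adj_irr G : irreflexive (adj G).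
Proof. by move=> x; apply/negP => /card_edge; rewrite setUid cards1. Qed.

Lemma sum_adj G : (\sum_x \sum_y adj G x y)%N = (2 * #|edges G|)%N.
Proof.
have -> : (2 * #|edges G|)%N = (\sum_(A in edges G) #|A|)%N.
  by rewrite (eq_bigr _ (fun A => @card_edge G A)) sum_nat_const mulnC.
under [RHS]eq_bigr => A _ do rewrite -sum1_card big_mkcond /=.
rewrite [RHS]exchange_big /=; apply: eq_bigr => x _.
transitivity #|[set A in edges G | x \in A]|; last first.
  by rewrite -sum1_card -big_mkcondr; apply: eq_bigl => A; rewrite inE.
transitivity #|[pred y | adj G x y]|.
  by rewrite -sum1_card [RHS]big_mkcond; apply: eq_bigr => y _; rewrite inE; case: (adj G x y).
rewrite -(@card_in_imset _ _ (fun y => [set x; y]) [pred y | adj G x y]).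
  apply: eq_card => A; rewrite !inE; apply/imsetP/andP.
    by case=> y xy ->; rewrite set21.
  case=> AG xA; have /eqP/cards2P[a [b [ab E]]] := card_edge AG.
  move: xA AG; rewrite E !inE => /orP[] /eqP -> AG; first by exists b.
  by exists a; rewrite ?inE /adj setUC.
move=> y z; rewrite !inE => xy _ /setP/(_ y); rewrite !inE eqxx orbT => /esym/orP[] /eqP // yx.
by move: xy; rewrite yx adj_irr.
Qed.

Lemma contains_complete G (t : nat) :
  contains_copy G (complete_graph t) = has_clique (adj G) t [set: T].
Proof.
apply/existsP/has_cliqueP => [[h /andP[/injectiveP hi /forall_inP he]]|[Q [_ cQ /cliqueP clQ]]].
  exists [set h i | i : 'I_t]; split=> //; first by rewrite card_imset // card_ord.
  apply/cliqueP => _ _ /imsetP[i _ ->] /imsetP[j _ ->] ij.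
  have := he [set i; j]; rewrite inE cards2 (contraNneq _ ij) => [/(_ isT)|-> //].
  by rewrite imsetU1 imset_set1.
have cst : #|'I_t| = #|Q| by rewrite card_ord cQ.
pose h := [ffun i : 'I_t => enum_val (cast_ord (esym cQ) i)].
have hi : injective h.
  by move=> i j; rewrite !ffunE => /enum_val_inj/cast_ord_inj.
exists h; apply/andP; split; first exact/injectiveP.
apply/forall_inP => A; rewrite inE => /cards2P[i [j [ij ->]]].
rewrite imsetU1 imset_set1; apply: clQ; rewrite ?ffunE ?enum_valP //.
by apply: contraNneq ij; rewrite -!(ffunE (fun i => enum_val (cast_ord (esym cQ) i))) => /hi ->.
Qed.

Lemma independentP G (S : {set T}) :
  reflect {in S &, forall x y, ~~ adj G x y} (independent G S).
Proof.
apply: (iffP forall_inP) => [h x y xS yS|h A AG].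
  by apply/negP => /h; rewrite subUset !sub1set xS yS.
have /eqP/cards2P[a [b [ab E]]] := card_edge AG.
rewrite E subUset !sub1set; apply/negP => /andP[aS bS].
by have := h a b aS bS; rewrite /adj -E AG.
Qed.

Lemma indep_number_ge G (S : {set T}) :
  {in S &, forall x y, ~~ adj G x y} -> (#|S| <= indep_number G)%N.
Proof. by move=> /independentP h; exact: (@leq_bigmax_cond _ (independent G) (fun S : {set T} => #|S|) S h). Qed.

Lemma indep_number_le G (a : nat) :
  (forall S : {set T}, {in S &, forall x y, ~~ adj G x y} -> (#|S| <= a)%N) ->
  (indep_number G <= a)%N.
Proof. by move=> h; apply/bigmax_leqP => S /independentP; apply: h. Qed.

Lemma graph_of_rel (e : rel T) : symmetric e -> irreflexive e ->
  exists G, adj G =2 e.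
Proof.
move=> es ei; pose E := [set A : {set T} | [exists x, exists y, e x y && (A == [set x; y])]].
have E2 : [forall A in E, #|A| == 2%N].
  apply/forall_inP => A; rewrite inE => /existsP[x /existsP[y /andP[xy /eqP ->]]].
  by rewrite cards2 (contraTneq _ xy) // => ->; rewrite ei.
exists (SGraph E2) => x y; rewrite /adj inE; apply/existsP/idP => [[a /existsP[b]]|xy].
  case/andP => ab /eqP/setP eq; have := eq x; have := eq y; have := eq a; have := eq b.
  rewrite !inE !eqxx !orbT /= => /orP[/eqP bx|/eqP bY] /orP[/eqP ax|/eqP ay];
    rewrite ?bx ?bY ?ax ?ay ?eqxx ?orbT ?orbb in ab *.
  - by rewrite ei in ab.
  - by rewrite es.
  - by [].
  - by rewrite ei in ab.
by exists x; apply/existsP; exists y; rewrite xy eqxx.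
Qed.

End Graphs.

Lemma eq_has_clique (T : finType) (e e' : rel T) k S :
  e =2 e' -> has_clique e k S = has_clique e' k S.
Proof.
move=> ee; apply: eq_existsb => Q; congr [&& _, _ & _].
by apply: eq_forallb_in => x _; apply: eq_forallb_in => y _; rewrite ee.
Qed.

Lemma leq_bigmin_cond (I : finType) (P : pred I) (F : I -> nat) (m : nat) (i : I) :
  P i -> (\big[minn/m]_(j | P j) F j <= F i)%N.
Proof.
move=> Pi; have : i \in index_enum I by rewrite mem_index_enum.
elim: (index_enum I) => // j s IH; rewrite inE big_cons => /predU1P[<-|/IH le].
  by rewrite Pi geq_minl.
by case: ifP => // _; rewrite geq_min le orbT.
Qed.

Lemma inverse_ramsey_le (t n : nat) (e : rel 'I_n) (a : nat) :
  symmetric e -> irreflexive e -> ~~ has_clique e t [set: 'I_n] ->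
  (forall S : {set 'I_n}, {in S &, forall x y, ~~ e x y} -> (#|S| <= a)%N) ->
  (inverse_ramsey t n <= a)%N.
Proof.
move=> es ei nK h; have [G Ge] := graph_of_rel es ei.
apply: (@leq_trans (indep_number G)).
  apply: (@leq_bigmin_cond _ (fun G : sgraph 'I_n => free_of (complete_graph t) G)
    (fun G => indep_number G)).
  by rewrite /free_of contains_complete (eq_has_clique _ _ Ge).
apply: indep_number_le => S hS; apply: h => x y xS yS; rewrite -Ge; exact: hS.
Qed.

Lemma indep_number_gt0 (n : nat) (G : sgraph 'I_n) : (0 < n)%N -> (0 < indep_number G)%N.
Proof.
case: n G => // n G _; apply: (@leq_trans #|[set (ord0 : 'I_n.+1)]|).
  by rewrite cards1.
by apply: indep_number_ge => x y; rewrite !inE => /eqP-> /eqP->; rewrite adj_irr.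
Qed.

Lemma inverse_ramsey_gt0 (t n : nat) : (0 < n)%N -> (0 < inverse_ramsey t n)%N.
Proof.
move=> n0; rewrite /inverse_ramsey; elim/big_ind: _ => // [x y x0 y0|G _].
  by rewrite leq_min x0 y0.
exact: indep_number_gt0.
Qed.

(* [k] disjoint copies of the graph induced on [S] have at least [n] vertices. *)
Lemma inverse_ramsey_copies (t n k : nat) (G : sgraph 'I_n) (S : {set 'I_n}) :
  (n <= k * #|S|)%N -> ~~ has_clique (adj G) t S ->
  (inverse_ramsey t n <= k * indep_number G)%N.
Proof.
move=> nk nK; pose D := setX [set: 'I_k] S.
have nD : (n <= #|D|)%N by rewrite cardsX cardsT card_ord.
pose phi (i : 'I_n) : 'I_k * 'I_n := enum_val (widen_ord nD i).
have phiS i : (phi i).2 \in S.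
  by have := enum_valP (widen_ord nD i); rewrite -/(phi i) inE => /andP[].
have phi_inj : injective phi.
  by move=> i j /enum_val_inj/(congr1 val)/= /val_inj.
pose e i j := ((phi i).1 == (phi j).1) && adj G (phi i).2 (phi j).2.
apply: (@inverse_ramsey_le t n e).
- by move=> i j; rewrite /e eq_sym adj_sym.
- by move=> i; rewrite /e adj_irr andbF.
- apply: contra nK => /has_cliqueP[Q [_ cQ /cliqueP clQ]]; apply/has_cliqueP.
  have inj : {in Q &, injective (fun i => (phi i).2)}.
    move=> i j iQ jQ eq2; apply/eqP/negPn/negP => ij.
    by have /andP[_] := clQ i j iQ jQ ij; rewrite eq2 adj_irr.
  exists [set (phi i).2 | i in Q]; split.
  + by apply/subsetP => _ /imsetP[i _ ->].
  + by rewrite card_in_imset.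
  apply/cliqueP => _ _ /imsetP[i iQ ->] /imsetP[j jQ ->] ij.
  have ne : i != j by apply: contraNneq ij => ->.
  by have /andP[] := clQ i j iQ jQ ne.
move=> I iI; rewrite -sum1_card (partition_big (fun i => (phi i).1) xpredT) //=.
apply: (@leq_trans (\sum_(c < k) indep_number G)%N); last by rewrite sum_nat_const card_ord.
apply: leq_sum => c _; rewrite sum1_card.
pose J := [set i in I | (phi i).1 == c].
have -> : #|[pred i | (i \in I) && ((phi i).1 == c)]| = #|J|.
  by apply: eq_card => i; rewrite !inE.
have inj : {in J &, injective (fun i => (phi i).2)}.
  move=> i j; rewrite !inE => /andP[_ /eqP ic] /andP[_ /eqP jc] eq2; apply: phi_inj.
  by rewrite (surjective_pairing (phi i)) (surjective_pairing (phi j)) ic jc eq2.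
rewrite -(card_in_imset inj); apply: indep_number_ge => _ _ /imsetP[i iJ ->] /imsetP[j jJ ->].
move: iJ jJ; rewrite !inE => /andP[iI' /eqP ic] /andP[jI /eqP jc].
by have := iI i j iI' jI; rewrite /e ic jc eqxx.
Qed.

From mathcomp Require Import all_classical all_reals all_analysis.
Import numFieldNormedType.Exports.
Local Open Scope ring_scope.

Lemma graph_edge_bound (R : realType) (gamma : R) : 0 < gamma ->
  exists2 delta : R, 0 < delta &
  exists n0 : nat, forall n : nat, (n0 <= n)%N ->
  forall G : sgraph 'I_n,
    free_of (complete_graph 12) G ->
    (indep_number G)%:R <= delta * (inverse_ramsey 4 n)%:R ->
    #|edges G|%:R <= (4 / 13 + gamma) * n%:R ^+ 2.
Proof.
move=> g0; have [M hM] : exists M : nat, M = (120 * (120 * 120))%N by eexists.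
have M0 : (0 < M)%N by rewrite hM !muln_gt0.
have [tau [w0 [tau0 main]]] := edge_bound hM g0; clear hM.
pose k := Num.Def.archi_bound tau^-1.
have ktau : 1 <= k%:R * tau.
  by rewrite -ler_pdivrMr // div1r ltW // archi_boundP // invr_ge0 ltW.
exists k.+1%:R^-1; first by rewrite invr_gt0.
have [c [cE c9 c4]] : exists c : R, [/\ c = 2 ^+ 19, 4 * 2 ^+ 9 <= c & 4 <= c].
  have h9 : 1 <= 2 ^+ 9 :> R by rewrite exprn_ege1 // ler1n.
  have h : 4 * 2 ^+ 9 <= 2 ^+ 19 :> R.
    rewrite (_ : 19 = 10 + 9)%N // exprD ler_wpM2r ?exprn_ge0 // -natrX ler_nat.
    by rewrite (_ : 4 = 2 ^ 2)%N // leq_exp2l.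
  by exists (2 ^+ 19); split=> //; lra.
pose W : R := c + 2 + `|w0|.
have W1 : c + 2 <= W by rewrite lerDl.
have W0 : 0 <= W by lra.
exists (Num.Def.archi_bound (W ^+ (40 * M))) => n hn G freeG alphaG.
have nW : W ^+ (40 * M) < n%:R.
  by apply: lt_le_trans (archi_boundP (exprn_ge0 _ W0)) _; rewrite ler_nat.
have n0 : (0 < n)%N by rewrite -(ltr_nat R); apply: le_lt_trans nW; rewrite exprn_ge0.
pose w : R := n%:R `^ (40 * M)%:R^-1.
have w_ge0 : 0 <= w by rewrite powR_ge0.
have m40 : (0 < 40 * M)%N by rewrite muln_gt0.
have wn : n%:R = w ^+ (40 * M).
  rewrite -powR_mulrn // -powRrM mulVf ?powRr1 //.
  by rewrite pnatr_eq0 -lt0n.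
have wW : W <= w.
  by rewrite -(ler_pXn2r m40) ?nnegrE // -wn ltW.
have w1 : 1 <= w by lra.
pose u := w ^+ (2 * M).
have uw : w <= u by rewrite /u -[leLHS]expr1 ler_weXn2l // muln_gt0.
have u20 : n%:R = u ^+ 20 by rewrite /u -exprM mulnAC.
pose y := Num.truncn (u / 4).
have u0 : 0 <= u / 4 by lra.
have /andP[yu1 yu2] := truncn_itv u0; rewrite -/y in yu1 yu2.
have y9 : (2 ^ 9 <= y)%N by rewrite truncn_ge_nat // natrX ler_pdivlMr //; lra.
have zu : u <= (4 * y.+1)%:R :> R by rewrite natrM; lra.
have zu2 : (4 * y.+1)%:R <= 2 * u :> R by rewrite natrM -natr1; lra.
have nz : (#|'I_n| <= (4 * y.+1) ^ 20)%N.
  by rewrite card_ord -(ler_nat R) natrX u20 lerXn2r ?nnegrE //; lra.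
have [e [es ei e4 eI]] := K4_free_small_alpha R y9 nz.
have Q9 := inverse_ramsey_le es ei e4 eI.
have Q0 := inverse_ramsey_gt0 4 n0.
have alphaQ : (k * indep_number G < inverse_ramsey 4 n)%N.
  rewrite -(ltr_nat R) natrM; move: alphaG; rewrite mulrC ler_pdivlMr // => alphaG.
  have [a0|a0] := posnP (indep_number G); first by rewrite a0 mulr0 ltr0n.
  apply: lt_le_trans alphaG; rewrite mulrC ltr_pM2l ?ltr0n //.
  by rewrite ltr_nat.
have k0 : (0 < k)%N.
  by rewrite -(ltr_nat R) ltNge; apply/negP => kl; have : k%:R * tau <= 0; [rewrite pmulr_lle0|lra].
have a9 : (indep_number G <= (4 * y.+1) ^ 9)%N.
  apply: leq_trans Q9; apply: ltnW; apply: leq_ltn_trans alphaQ; exact: leq_pmull.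
have bound := main _ (adj G) w (@adj_sym _ G) (@adj_irr _ G).
have {bound} : \sum_x \sum_y (adj G x y)%:R <= (8 / 13 + gamma) * #|'I_n|%:R ^+ 2 :> R.
  apply: bound => //; first by apply: le_trans wW; apply: le_trans (ler_norm _) _; rewrite lerDr; lra.
  - by rewrite card_ord.
  - move=> S; rewrite card_ord => hS.
    have [//|nK] := boolP (has_clique (adj G) 4 S).
    have nS : (n <= k * #|S|)%N.
      rewrite -(ler_nat R) natrM; have := ler_wpM2l (ler0n R k) hS.
      apply: le_trans; rewrite mulrA ler_peMl //.
    by have := inverse_ramsey_copies nS nK; rewrite leqNgt alphaQ.
  - move=> S hS; apply: (triangle_of_large (@adj_sym _ G) (@adj_irr _ G) (a := indep_number G)).
      by move=> I; apply: indep_number_ge.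
    rewrite -(ltr_nat R); apply: lt_le_trans hS.
    have z0 : (0 < 4 * y.+1)%N by [].
    move: (4 * y.+1)%N z0 zu zu2 a9 => z z0 zu zu2 a9.
    have a9r : (indep_number G + indep_number G * indep_number G)%:R <= 2 * (z%:R : R) ^+ 18.
      have z1 : (0 < z ^ 9)%N by rewrite expn_gt0 z0.
      have -> : 2 * (z%:R : R) ^+ 18 = (2 * z ^ (9 + 9))%:R.
        by rewrite natrM natrX.
      rewrite ler_nat expnD; move: (z ^ 9)%N z1 a9 => a a0 ha.
      rewrite mul2n -addnn; apply: leq_add; last exact: leq_mul.
      exact: leq_trans ha (leq_pmull _ a0).
    apply: le_lt_trans a9r _.
    have z18 : 2 * (z%:R : R) ^+ 18 <= c * u ^+ 18.
      rewrite cE [2 ^+ 19]exprS -mulrA ler_wpM2l // -exprMn lerXn2r ?nnegrE //; lra.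
    apply: le_lt_trans z18 _.
    have u18 : 1 <= u ^+ 18 by rewrite exprn_ege1 //; lra.
    have w39 : u ^+ 19 <= w ^+ (39 * M).
      by rewrite /u -exprM ler_weXn2l // mulnAC leq_mul2r orbT.
    have u19 : (c + 2) * u ^+ 18 <= u ^+ 19.
      by rewrite [leRHS]exprS ler_wpM2r //; lra.
    clear - u18 w39 u19.
    lra.
  - by rewrite -contains_complete.
have -> : \sum_x \sum_y (adj G x y)%:R = (2 * #|edges G|)%:R :> R.
  by rewrite -sum_adj natr_sum; apply: eq_bigr => x _; rewrite natr_sum.
rewrite card_ord natrM; have : 0 <= gamma * n%:R ^+ 2 by rewrite mulr_ge0 ?sqr_ge0 // ltW.
lra.
Qed.

Local Open Scope classical_set_scope.
Local Open Scope ring_scope.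

Lemma le_limn_esup (R : realType) (u v : nat -> \bar R) :
  (forall n, (u n <= v n)%E) -> (limn_esup u <= limn_esup v)%E.
Proof.
move=> uv; apply: le_ereal_inf_tmp => _ [A FA <-]; apply: ge_ereal_inf.
exists (ereal_sup [set u x | x in A]); first by exists A.
apply: ge_ereal_sup => _ [n An <-]; apply: le_trans (uv n) _.
by apply: ereal_sup_ubound; exists n.
Qed.

Lemma limn_esup_le (R : realType) (u : nat -> \bar R) (c : \bar R) (n0 : nat) :
  (forall n, (n0 <= n)%N -> (u n <= c)%E) -> (limn_esup u <= c)%E.
Proof.
move=> uc; apply: ge_ereal_inf; exists (ereal_sup [set u x | x in [set n | (n0 <= n)%N]]).
  by exists [set n | (n0 <= n)%N] => //; exists n0.
by apply: ge_ereal_sup => _ [n hn <-]; apply: uc.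
Qed.

Lemma le_ramsey_turan (R : realType) (U : finType) (n : nat) (H : sgraph U) (x y : R) :
  x <= y -> (ramsey_turan n H x <= ramsey_turan n H y)%N.
Proof.
move=> xy; apply/bigmax_leqP => G /andP[fG aG].
apply: (@leq_bigmax_cond _ (fun G => _ && _) (fun G : sgraph 'I_n => #|edges G|)).
by rewrite fG (le_trans aG).
Qed.

Lemma rho_tau_sup_scaled_homo (R : realType) (U : finType) (H : sgraph U) (f : nat -> R) :
  (forall n, 0 <= f n) ->
  {homo rho_tau_sup_scaled H f : x y / x <= y >-> (x <= y)%E}.
Proof.
move=> f0 x y xy; apply: le_limn_esup => n; rewrite lee_fin.
by rewrite ler_wpM2r ?invr_ge0 ?sqr_ge0 // ler_nat le_ramsey_turan // ler_wpM2r.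
Qed.

Theorem theorem1p5 (R : realType) :
  let Q4 : nat -> R := fun n => (inverse_ramsey 4 n)%:R in
  [/\ cvg (rho_tau_sup_scaled (complete_graph 12) Q4 delta @[delta --> 0^'+]),
      (rho_tau_sup_o (complete_graph 12) Q4 <= (4 / 13)%:E)%E
    & forall gamma : R, 0 < gamma ->
      exists2 delta : R, 0 < delta &
      exists n0 : nat, forall n : nat, (n0 <= n)%N ->
      forall G : sgraph 'I_n,
        free_of (complete_graph 12) G ->
        (indep_number G)%:R <= delta * Q4 n ->
        #|edges G|%:R <= (4 / 13 + gamma) * n%:R ^+ 2].
Proof.
move=> Q4; have Q0 n : 0 <= Q4 n by [].
have bd : (BRight (0 : R) < +oo%O)%O by [].
have lim := nondecreasing_at_right_cvge +oo%O bd
  (fun x y _ _ => @rho_tau_sup_scaled_homo R _ (complete_graph 12) Q4 Q0 x y).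
split; [by apply/cvg_ex; eexists; exact: lim| |exact: graph_edge_bound].
rewrite /rho_tau_sup_o (cvg_lim _ lim) //; apply/lee_addgt0Pr => gamma g0.
have [delta d0 [n0 hn0]] := graph_edge_bound g0.
apply: ge_ereal_inf; exists (rho_tau_sup_scaled (complete_graph 12) Q4 delta).
  by exists delta => //=; rewrite in_itv /= d0.
apply: (@limn_esup_le _ _ _ n0.+1) => n hn; rewrite -EFinD lee_fin.
have n_gt0 : 0 < n%:R ^+ 2 :> R by rewrite exprn_gt0 // ltr0n; apply: leq_trans hn.
rewrite ler_pdivrMr //; rewrite /ramsey_turan.
elim/big_ind: _ => [|a b ha hb|G /andP[fG aG]].
- by rewrite mulr_ge0 ?addr_ge0 ?divr_ge0 // ltW.
- by rewrite /maxn; case: ifP.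
- exact: hn0 (ltnW hn) G fG aG.
Qed.
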